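(* Let $\mathbb{F}$ be a field of characteristic that is not $2$ and let $L$ be a nilpotent symplectic alternating algebra over $\mathbb{F}$ of dimension $10$ that has an isotropic center of dimension $3$. Suppose also that $L$ has the further properties that $\dim L^3=6$, $L^3L^2=L^5$ and $L$ is of type $C$. Then $L$ has a presentation of the form $$\mathcal{P}_{10}^{(3,8)}(r,s):\quad (x_2y_4,y_5)=r,\ (x_1y_3,y_5)=s,\ (x_1y_2,y_4)=1,\ (y_1y_2,y_5)=1,\ (y_1y_3,y_4)=1,$$ where $r,s\in\mathbb{F}$, $r\neq 0$ and $s\notin\mathbb{F}^2$. Furthermore the presentations $\mathcal{P}_{10}^{(3,8)}(\tilde r,\tilde s)$ and $\mathcal{P}_{10}^{(3,8)}(r,s)$ (both with parameters satisfying these conditions) describe the same algebra if and only if $\frac{\tilde r}{r}\in(\mathbb{F}^* )^3$ and $\frac{s}{\tilde s}\in G(s)$, where $G(s)=\{(x^2-y^2s)^2:\ (x,y)\in\mathbb{F}\times\mathbb{F}\setminus\{(0,0)\}\}$.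
   Context: A symplectic alternating algebra (SAA) over a field $\mathbb{F}$ is a finite-dimensional vector space $L$ over $\mathbb{F}$ with a non-degenerate alternating bilinear form $(\ ,\ )$ and a bilinear product $\cdot$ satisfying $u\cdot u=0$ for all $u$ and $(u\cdot v,w)=(v\cdot w,u)$ for all $u,v,w\in L$. No associativity or Jacobi identity is assumed. The map $(u,v,w)\mapsto(uv,w)$ is then an alternating trilinear form. A standard basis (in dimension $10$) is a basis $x_1,y_1,\ldots,x_5,y_5$ with $(x_i,x_j)=(y_i,y_j)=0$ and $(x_i,y_j)=\delta_{ij}$ for all $i,j$. Presentations: $L$ has a presentation if there is a standard basis for which the listed values of triples $(uv,w)$ hold and $(uv,w)=0$ for all triples of basis elements that are not a reordering of a listed one. Two presentations describe the same algebra if the corresponding $10$-dimensional SAA's are isomorphic (by a linear bijection preserving product and form). $\mathbb{F}^*=\mathbb{F}\setminus\{0\}$, $(\mathbb{F}^* )^3=\{a^3:a\in\mathbb{F}^*\}$, $\mathbb{F}^2=\{a^2:a\in\mathbb{F}\}$ is the set of squares. For subspaces $U,V$, $UV$ is the span of all products $uv$. $L^1=L$, $L^{m+1}=L^mL$; $Z_0(L)=\{0\}$, $Z_{m+1}(L)=\{x: xL\leq Z_m(L)\}$, $Z(L)=Z_1(L)$. $L$ is nilpotent if $L^{m+1}=\{0\}$ for some $m\ge 0$. $Z(L)$ is isotropic if $(u,v)=0$ for all $u,v\in Z(L)$. Type: let $L$ be nilpotent of dimension $10$ with isotropic center of dimension $3$, $\dim L^3=6$ and $L^3L^2=L^5$.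 Then one can choose a standard basis with $L^5=\mathbb{F}x_5+\mathbb{F}x_4$, $Z(L)=L^5+\mathbb{F}x_3$, $L^4=Z_2(L)=Z(L)+\mathbb{F}x_2$, $L^3=Z_3(L)=L^4+\mathbb{F}x_1+\mathbb{F}y_1$, $L^2=L^3+\mathbb{F}y_2$, $Z_4(L)=L^2+\mathbb{F}y_3$. The linear maps $\phi,\psi:L^3/L^4\to L^5$, $\phi(u+L^4)=uy_2$, $\psi(u+L^4)=uy_3$ are well defined, $\phi$ is bijective, and the minimal polynomial of $\tau=\psi\phi^{-1}:L^5\to L^5$ has degree $2$. $L$ is of type $C$ if this minimal polynomial is irreducible in $\mathbb{F}[t]$; this does not depend on the choice of such a standard basis. *)

(* Defs.v *)
From HB Require Import structures.
From mathcomp Require Import all_boot all_order all_algebra.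

Set Implicit Arguments.
Unset Strict Implicit.
Unset Printing Implicit Defensive.

Import GRing.Theory.
Local Open Scope ring_scope.

(* Finite dimension is part of vectType. *)
Record saa (F : fieldType) := SAA {
  saa_vect :> vectType F;
  saa_form : {bilinear saa_vect -> saa_vect -> F | *%R & *%R};
  saa_mul : {bilinear saa_vect -> saa_vect -> saa_vect};
  saa_form_alt : forall u, saa_form u u = 0;
  saa_form_nondeg : forall u, (forall v, saa_form u v = 0) -> u = 0;
  saa_mul_alt : forall u, saa_mul u u = 0;
  saa_form_mul : forall u v w,
    saa_form (saa_mul u v) w = saa_form (saa_mul v w) u
}.
Arguments saa_form {F s}.
Arguments saa_mul {F s}.

Section Subspaces.
Variables (F : fieldType) (L : saa F).
Implicit Types (U V W : {vspace L}) (u v w : L).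

Definition saa_rmul v : 'End(L) := linfun (applyr saa_mul v).

Lemma saa_rmulE v u : saa_rmul v u = saa_mul u v.
Proof. by rewrite lfunE. Qed.

(* The span of all products u v with u in U and v in V (see saa_prodvP); as for
   prodv in falgebra, products of basis vectors suffice. *)
Definition saa_prodv U V : {vspace L} :=
  <<[seq saa_mul u v | u <- vbasis U, v <- vbasis V]>>%VS.

Lemma saa_prodvP U V W :
  reflect (forall u v, u \in U -> v \in V -> saa_mul u v \in W)
          (saa_prodv U V <= W)%VS.
Proof.
apply: (iffP idP) => [/subvP sW u v Uu Vv | sW].
  rewrite (coord_vbasis Uu) (coord_vbasis Vv) linear_sumlz rpred_sum // => i _.
  rewrite linear_sumr rpred_sum // => j _.
  rewrite linearZl_LR linearZr_LR !rpredZ // sW // memv_span //.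
  by apply: allpairs_f; apply: mem_nth; rewrite size_tuple.
apply/span_subvP=> _ /allpairsP[[u v] /= [Uu Vv ->]].
by apply: sW; apply: vbasis_mem.
Qed.

(* L^m, meaningful for m >= 1: L^1 = L and L^(m+1) = L^m L. *)
Definition saa_lcs m : {vspace L} :=
  iter m.-1 (fun U => saa_prodv U fullv) fullv.

Definition saa_nilpotent := exists m, saa_lcs m.+1 = 0%VS.

Fixpoint saa_ucs m : {vspace L} :=
  if m is k.+1 then
    (\bigcap_(v <- vbasis fullv) (saa_rmul v @^-1: saa_ucs k))%VS
  else 0%VS.

Lemma saa_ucsSP m u :
  reflect (forall v, saa_mul u v \in saa_ucs m) (u \in saa_ucs m.+1).
Proof.
have capP (s : seq L) :
    (u \in (\bigcap_(v <- s) (saa_rmul v @^-1: saa_ucs m))%VS) =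
    all (fun v => saa_mul u v \in saa_ucs m) s.
  elim: s => [|v s IHs]; first by rewrite big_nil memvf.
  by rewrite big_cons memv_cap IHs /= -memv_preim saa_rmulE.
rewrite /= capP; apply: (iffP allP) => [Zu v | Zu v _]; last exact: Zu.
rewrite (coord_vbasis (memvf v)) linear_sumr rpred_sum // => i _.
rewrite linearZr_LR rpredZ // Zu //.
by apply: mem_nth; rewrite size_tuple.
Qed.

Definition saa_center := saa_ucs 1.

Definition saa_isotropic U := forall u v, u \in U -> v \in U -> saa_form u v = 0.

End Subspaces.

Definition saa_isomorphic (F : fieldType) (L M : saa F) :=
  exists f : 'Hom(L, M),
    [/\ bijective f,
        forall u v, f (saa_mul u v) = saa_mul (f u) (f v)
      & forall u v, saa_form (f u) (f v) = saa_form u v].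

(* Labels of the vectors of a standard basis: lx k stands for x_k and ly k for
   y_k, with 1 <= k <= 5. *)
Definition label : finType := ('I_5 + 'I_5)%type.
Definition lx (k : nat) : label := inl (inZp k.-1).
Definition ly (k : nat) : label := inr (inZp k.-1).

Definition standard_basis (F : fieldType) (L : saa F) (e : label -> L) :=
  [/\ basis_of fullv (codom e),
      forall i j, saa_form (e (inl i)) (e (inl j)) = 0,
      forall i j, saa_form (e (inr i)) (e (inr j)) = 0
    & forall i j, saa_form (e (inl i)) (e (inr j)) = (i == j)%:R].

(* The entry (a, b, c, z) stands for (ab, c) = z. *)
Definition presentation (F : fieldType) := seq (label * label * label * F).

Definition has_presentation (F : fieldType) (L : saa F) (p : presentation F) :=
  exists e : label -> L,
    [/\ standard_basis e,
        forall a b c z, (a, b, c, z) \in p ->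
          saa_form (saa_mul (e a) (e b)) (e c) = z
      & forall a b c,
          (forall a' b' c' z, (a', b', c', z) \in p ->
             ~~ perm_eq [:: a; b; c] [:: a'; b'; c']) ->
          saa_form (saa_mul (e a) (e b)) (e c) = 0].

(* A presentation determines its algebra up to isomorphism, see
   has_presentation_isomorphic. *)
Definition same_algebra (F : fieldType) (p q : presentation F) :=
  exists L M : saa F,
    [/\ has_presentation L p, has_presentation M q & saa_isomorphic L M].

Section PresentationUnique.
Variable F : fieldType.

Let tri (L : saa F) (u v w : L) := saa_form (saa_mul u v) w.

Let tri_rot (L : saa F) (u v w : L) : tri u v w = tri v w u.
Proof. exact: saa_form_mul. Qed.

Let tri_swap (L : saa F) (u v w : L) : tri u v w = - tri v u w.
Proof.
have /eqP := saa_mul_alt (u + v).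
rewrite linearDl !linearDr !saa_mul_alt add0r addr0 addr_eq0 => /eqP Duv.
by rewrite /tri Duv linearNl.
Qed.

Let basis_ext (L : saa F) (V : lmodType F) (e : label -> L)
    (f g : L -> V) : linear f -> linear g ->
  basis_of fullv (codom e) -> (forall a, f (e a) = g (e a)) -> f =1 g.
Proof.
move=> lf lg Be efg u.
pose mf := GRing.isLinear.Build _ _ _ _ f lf.
pose mg := GRing.isLinear.Build _ _ _ _ g lg.
pose f' : {linear L -> V} := HB.pack f mf.
pose g' : {linear L -> V} := HB.pack g mg.
rewrite -[f u]/(f' u) -[g u]/(g' u).
have Bt : basis_of fullv (codom_tuple e) by [].
rewrite (coord_basis Bt (memvf u)) !linear_sum; apply: eq_bigr => i _.
rewrite !linearZ; congr (_ *: _).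
have /codomP[a ->] : (codom_tuple e)`_i \in codom e.
  by apply: mem_nth; rewrite -[size _]/(size (codom_tuple e)) size_tuple.
exact: efg.
Qed.

Let basis_map (L M : saa F) (e : label -> L) (e' : label -> M) :
  basis_of fullv (codom e) -> {f : 'Hom(L, M) | forall a, f (e a) = e' a}.
Proof.
move=> Be; have [f fE] := linear_of_free (codom e) (codom e').
exists (linfun f) => a; rewrite lfunE /=.
have szE : size (codom e') = size (codom e) by rewrite !size_codom.
have := fE (basis_free Be) szE; rewrite -map_comp => /eq_in_map/(_ a).
by apply; rewrite mem_enum.
Qed.

Lemma has_presentation_isomorphic (p : presentation F) (L M : saa F) :
  has_presentation L p -> has_presentation M p -> saa_isomorphic L M.
Proof.
move=> [e [[Be exx eyy exy] ep e0]] [e' [[Be' e'xx e'yy e'xy] ep' e0']].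
have [f fE] := basis_map e' Be; have [g gE] := basis_map e Be'.
have fK : cancel f g.
  apply: (basis_ext (f := g \o f) (g := id) _ _ Be _) => //=.
  - by move=> c u v /=; rewrite !linearP.
  - by move=> a /=; rewrite fE gE.
have gK : cancel g f.
  apply: (basis_ext (f := f \o g) (g := id) _ _ Be' _) => //=.
  - by move=> c u v /=; rewrite !linearP.
  - by move=> a /=; rewrite gE fE.
have form_sym (N : saa F) (u v : N) : saa_form u v = - saa_form v u.
  have /eqP := saa_form_alt (u + v).
  by rewrite linearDl !linearDr !saa_form_alt add0r addr0 addr_eq0 => /eqP.
have formE u v : saa_form (f u) (f v) = saa_form u v.
  move: u; apply: (basis_ext (V := F^o) (f := fun u => saa_form (f u) (f v))
                    (g := fun u => saa_form u v) _ _ Be _).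
  - by move=> c u w; rewrite linearP linearPl.
  - by move=> c u w; rewrite linearPl.
  move=> a; move: v; apply: (basis_ext (V := F^o)
    (f := fun v => saa_form (f (e a)) (f v)) (g := saa_form (e a)) _ _ Be _).
  - by move=> c u w; rewrite linearP linearPr.
  - by move=> c u w; rewrite linearPr.
  move=> b; rewrite !fE; case: a b => [i|i] [j|j].
  - by rewrite exx e'xx.
  - by rewrite exy e'xy.
  - by rewrite form_sym e'xy (form_sym _ (e (inr i))) exy.
  - by rewrite eyy e'yy.
have triE a b c : tri (e' a) (e' b) (e' c) = tri (e a) (e b) (e c).
  have [/hasP[[[[a' b'] c'] z] pz eqp] | /hasPn no] :=
    boolP (has (fun t => perm_eq [:: a; b; c] [:: t.1.1.1; t.1.1.2; t.1.2]) p);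
    last first.
    have no' a' b' c' z : (a', b', c', z) \in p ->
      ~~ perm_eq [:: a; b; c] [:: a'; b'; c'] by move/no.
    by rewrite /tri e0 // e0'.
  have T : tri (e' a') (e' b') (e' c') = tri (e a') (e b') (e c').
    by rewrite /tri (ep _ _ _ _ pz) (ep' _ _ _ _ pz).
  move: eqp => /=; rewrite -mem_permutations.
  have T' := T; rewrite tri_swap [RHS]tri_swap in T'; have {}T' := oppr_inj T'.
  have R := T; rewrite tri_rot [RHS]tri_rot in R.
  have R2 := R; rewrite tri_rot [RHS]tri_rot in R2.
  have R' := T'; rewrite tri_rot [RHS]tri_rot in R'.
  have R2' := R'; rewrite tri_rot [RHS]tri_rot in R2'.
  rewrite mem_permutations => eqp.
  have := perm_mem eqp a; rewrite !inE eqxx /= => /esym /or3P[] /eqP Ea;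
    move: eqp; rewrite Ea.
  - rewrite perm_cons => eqp; have := perm_mem eqp b.
    rewrite !inE eqxx /= => /esym /orP[] /eqP Eb; move: eqp; rewrite Eb.
    + by rewrite perm_cons => /perm_mem/(_ c); rewrite !inE eqxx => /esym/eqP ->.
    + rewrite perm_sym -(perm_catC [:: c'] [:: b']) perm_sym /= perm_cons.
      by move=> /perm_mem/(_ c); rewrite !inE eqxx => /esym/eqP ->.
  - rewrite perm_sym -(perm_catCA [:: b'] [:: a'] [:: c']) perm_sym /= perm_cons => eqp; have := perm_mem eqp b.
    rewrite !inE eqxx /= => /esym /orP[] /eqP Eb; move: eqp; rewrite Eb.
    + by rewrite perm_cons => /perm_mem/(_ c); rewrite !inE eqxx => /esym/eqP ->.
    + rewrite perm_sym -(perm_catC [:: c'] [:: a']) perm_sym /= perm_cons.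
      by move=> /perm_mem/(_ c); rewrite !inE eqxx => /esym/eqP ->.
  - rewrite perm_sym -(perm_catC [:: c'] [:: a'; b']) perm_sym /= perm_cons => eqp; have := perm_mem eqp b.
    rewrite !inE eqxx /= => /esym /orP[] /eqP Eb; move: eqp; rewrite Eb.
    + by rewrite perm_cons => /perm_mem/(_ c); rewrite !inE eqxx => /esym/eqP ->.
    + rewrite perm_sym -(perm_catC [:: b'] [:: a']) perm_sym /= perm_cons.
      by move=> /perm_mem/(_ c); rewrite !inE eqxx => /esym/eqP ->.
exists f; split=> //; first by exists g.
have triF u v w : tri (f u) (f v) (f w) = tri u v w.
  move: u; apply: (basis_ext (V := F^o) (f := fun u => tri (f u) (f v) (f w))
                    (g := fun u => tri u v w) _ _ Be _).
  - by move=> c x y; rewrite /tri linearP linearPl linearPl.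
  - by move=> c x y; rewrite /tri !linearPl.
  move=> a; move: v; apply: (basis_ext (V := F^o)
    (f := fun v => tri (f (e a)) (f v) (f w)) (g := fun v => tri (e a) v w) _ _ Be _).
  - by move=> c x y; rewrite /tri linearP linearPr linearPl.
  - by move=> c x y; rewrite /tri linearPr linearPl.
  move=> b; move: w; apply: (basis_ext (V := F^o)
    (f := fun w => tri (f (e a)) (f (e b)) (f w)) (g := tri (e a) (e b)) _ _ Be _).
  - by move=> c x y; rewrite /tri linearP linearPr.
  - by move=> c x y; rewrite /tri linearPr.
  by move=> c; rewrite !fE triE.
move=> u v; apply/eqP; rewrite -subr_eq0; apply/eqP/saa_form_nondeg => w.
rewrite -(gK w) linearBl /= formE -[saa_form (saa_mul (f u) _) _]/(tri (f u) (f v) (f (g w))).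
by rewrite triF subrr.
Qed.

End PresentationUnique.

Definition P10_3_8 (F : fieldType) (r s : F) : presentation F :=
  [:: (lx 2, ly 4, ly 5, r); (lx 1, ly 3, ly 5, s); (lx 1, ly 2, ly 4, 1);
      (ly 1, ly 2, ly 5, 1); (ly 1, ly 3, ly 4, 1)].

Section TypeC.
Variables (F : fieldType) (L : saa F).
Implicit Type e : label -> L.

Definition adapted_basis e :=
  [/\ standard_basis e,
      saa_lcs L 5 = (<[e (lx 5)]> + <[e (lx 4)]>)%VS,
      saa_center L = (saa_lcs L 5 + <[e (lx 3)]>)%VS
    & [/\ saa_lcs L 4 = saa_ucs L 2,
          saa_lcs L 4 = (saa_center L + <[e (lx 2)]>)%VS,
          saa_lcs L 3 = saa_ucs L 3,
          saa_lcs L 3 = (saa_lcs L 4 + <[e (lx 1)]> + <[e (ly 1)]>)%VS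
        & saa_lcs L 2 = (saa_lcs L 3 + <[e (ly 2)]>)%VS /\
          saa_ucs L 4 = (saa_lcs L 2 + <[e (ly 3)]>)%VS]].

(* phi : u |-> u y_2 and psi : u |-> u y_3 on L^3, before passing to the quotient
   of their domain by L^4. *)
Definition phi_map e : 'Hom(subvs_of (saa_lcs L 3), L) :=
  (saa_rmul (e (ly 2)) \o linfun vsval)%VF.
Definition psi_map e : 'Hom(subvs_of (saa_lcs L 3), L) :=
  (saa_rmul (e (ly 3)) \o linfun vsval)%VF.

(* phi^-1 is a section of phi over its image. When phi has image L^5 and kernel
   L^4, and psi kills L^4, the restriction of tau_map to L^5 is the composite of
   the induced map psi : L^3/L^4 -> L^5 with the inverse of the induced
   bijection phi : L^3/L^4 -> L^5. *)
Definition tau_map e : 'End(L) := (psi_map e \o (phi_map e)^-1)%VF.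

(* The matrix of tau : L^5 -> L^5 in the basis (x_5, x_4), with the coordinates
   of the images as rows. *)
Definition tau_mx e : 'M[F]_2 :=
  let b := [tuple e (lx 5); e (lx 4)] in
  \matrix_(i < 2, j < 2) coord b j (tau_map e (tnth b i)).

Definition type_C :=
  exists2 e, adapted_basis e & irreducible_poly (mxminpoly (tau_mx e)).

End TypeC.

Section ParameterSets.
Variable F : fieldType.

Definition is_square (z : F) := exists a, z = a ^+ 2.

Definition is_nonzero_cube (z : F) := exists2 a, a != 0 & z = a ^+ 3.

Definition inG (s z : F) :=
  exists x y, (x, y) != (0, 0) /\ z = (x ^+ 2 - y ^+ 2 * s) ^+ 2.

Definition admissible (r s : F) := r != 0 /\ ~ is_square s.

End ParameterSets.

(* Main.v *)
Require Import Defs.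
From HB Require Import structures.
From mathcomp Require Import all_boot all_order all_algebra ring zify.

Set Implicit Arguments.
Unset Strict Implicit.
Unset Printing Implicit Defensive.

Import GRing.Theory.
Local Open Scope ring_scope.

(** The product of a symplectic alternating algebra is determined by the
    alternating trilinear form (u, v, w) |-> (uv, w). In a standard basis a
    presentation therefore says that this form is a given combination of 3 x 3
    minors of the coordinates of u, v and w ([cubic]), and passing to another
    standard basis is a linear substitution that preserves the symplectic form
    ([change_basis]). Finding a presentation is thus a matter of finding a
    substitution, and checking it is a matter of two polynomial identities.

    Existence. For an adapted basis, the two central series and L^3 L^2 = L^5
    leave fifteen triples of basis vectors on which the form may be nonzero
    ([adapted_presents]). Among these values are the matrix Phi of phi, that is
    of multiplication of x1, y1 by y2, and the matrix Psi of psi, that is of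
    multiplication by y3, both with values in L^5. Phi is invertible because
    L^3 L^2 = L^5. As tau is psi after the inverse of phi, an eigenvalue z of
    tau is a root of det (Psi - z Phi). If the minimal polynomial of tau had
    such a root it would be linear, being irreducible, so Psi = z Phi, and
    y3 - z y2 would lie in Z_3 = L^3, which is absurd ([psi_no_root]). Replacing
    x4, x5 by x1 y2, y1 y2 makes Phi the identity; removing half the trace of
    Psi from y3 with the help of y2 (here the characteristic is not 2) and
    rescaling makes Psi the companion matrix of t^2 - s, with s not a square.
    The other values are then removed by symplectic shears ([normalize_rest]).

    Isomorphism. The base changes realizing the equivalences are written down
    explicitly ([presents_rescale]); together with an algebra having the given
    presentation ([model]) they give one implication. Conversely, the terms of
    the upper central series of the algebra with parameters (r, s) are spanned
    by basis vectors ([ucs1_vanishes] to [ucs4_vanishes]), so the matrix of a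
    change of basis is block triangular. Comparing the values of the trilinear
    form on both bases, the diagonal blocks satisfy equations
    ([parameters_of_block]) which force r' = k^3 r and s = s' N^2 for a norm
    N = x^2 - y^2 s. *)

(** * Alternating cubic forms in coordinates *)

(** The order x1 < ... < x5 < y1 < ... < y5, in which every triple listed by a
    presentation below is increasing. *)
Definition rank (a : label) : nat :=
  match a with inl i => i | inr i => (5 + i)%N end.

Lemma rankE :
  ((rank (lx 1) = 0%N) * (rank (lx 2) = 1%N) * (rank (lx 3) = 2%N) *
   (rank (lx 4) = 3%N) * (rank (lx 5) = 4%N) * (rank (ly 1) = 5%N) *
   (rank (ly 2) = 6%N) * (rank (ly 3) = 7%N) * (rank (ly 4) = 8%N) *
   (rank (ly 5) = 9%N))%type.
Proof. by []. Qed.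

Lemma rank_inj : injective rank.
Proof.
move=> [i|i] [j|j] /= eq_ij.
- by congr inl; apply: val_inj.
- by have := ltn_ord i; rewrite eq_ij ltnNge leq_addr.
- by have := ltn_ord j; rewrite -eq_ij ltnNge leq_addr.
- by congr inr; apply: val_inj; apply: (@addnI 5).
Qed.

Lemma inlE (i : 'I_5) : inl i = lx i.+1 :> label.
Proof. by congr inl; apply: val_inj; rewrite /= modn_small. Qed.

Lemma inrE (i : 'I_5) : inr i = ly i.+1 :> label.
Proof. by congr inr; apply: val_inj; rewrite /= modn_small. Qed.

Lemma label_ind (P : label -> Prop) :
    P (lx 1) -> P (lx 2) -> P (lx 3) -> P (lx 4) -> P (lx 5) ->
    P (ly 1) -> P (ly 2) -> P (ly 3) -> P (ly 4) -> P (ly 5) ->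
  forall a, P a.
Proof.
move=> ? ? ? ? ? ? ? ? ? ? [] i; rewrite (inlE, inrE).
  by case: i => [[|[|[|[|[|//]]]]] lt_i].
by case: i => [[|[|[|[|[|//]]]]] lt_i].
Qed.

Section Coordinates.
Variable F : fieldType.
Implicit Types (u v w : label -> F) (p q : presentation F).

(** A coordinate vector given by its ten entries in the order of the ranks. *)
Definition entries (s : seq F) : label -> F := fun a => s`_(rank a).

(** Phrased with ranks so that [rankE] evaluates it at explicit labels. *)
Definition delta (a b : label) : F := (rank a == rank b)%:R.

Lemma deltaE a b : delta a b = (a == b)%:R.
Proof. by rewrite /delta (inj_eq rank_inj). Qed.

Lemma delta_sum u b : \sum_a u a * delta a b = u b.
Proof.
rewrite (bigD1 b) //= deltaE eqxx mulr1 big1 ?addr0 // => a nab.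
by rewrite deltaE (negPf nab) mulr0.
Qed.

(** The wedge product of the coordinate covectors i, j and k. *)
Definition det3 (i j k : label) u v w : F :=
  u i * (v j * w k - v k * w j) + u j * (v k * w i - v i * w k)
  + u k * (v i * w j - v j * w i).

Definition cubic p u v w : F :=
  \sum_(t <- p) t.2 * det3 t.1.1.1 t.1.1.2 t.1.2 u v w.

Definition sympl u v : F :=
  \sum_(i < 5) (u (inl i) * v (inr i) - u (inr i) * v (inl i)).

Lemma symplE u v :
  sympl u v = u (lx 1) * v (ly 1) - u (ly 1) * v (lx 1)
    + (u (lx 2) * v (ly 2) - u (ly 2) * v (lx 2))
    + (u (lx 3) * v (ly 3) - u (ly 3) * v (lx 3))
    + (u (lx 4) * v (ly 4) - u (ly 4) * v (lx 4))
    + (u (lx 5) * v (ly 5) - u (ly 5) * v (lx 5)).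
Proof.
rewrite /sympl; under eq_bigr => i _ do rewrite inlE inrE.
by rewrite !big_ord_recr big_ord0 /= add0r.
Qed.


Lemma det3_rot i j k u v w : det3 i j k u v w = det3 i j k v w u.
Proof. rewrite /det3; ring. Qed.

Lemma det3_swap i j k u v w : det3 i j k u v w = - det3 i j k v u w.
Proof. rewrite /det3; ring. Qed.

Lemma det3_alt i j k u w : det3 i j k u u w = 0.
Proof. rewrite /det3; ring. Qed.

Lemma cubic_rot p u v w : cubic p u v w = cubic p v w u.
Proof. by apply: eq_bigr => t _; rewrite det3_rot. Qed.

Lemma cubic_swap p u v w : cubic p u v w = - cubic p v u w.
Proof. by rewrite -sumrN; apply: eq_bigr => t _; rewrite det3_swap mulrN. Qed.

Lemma cubic_alt p u w : cubic p u u w = 0.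
Proof. by rewrite /cubic big1 // => t _; rewrite det3_alt mulr0. Qed.

Lemma eq_det3 i j k u u' v v' w w' :
  u =1 u' -> v =1 v' -> w =1 w' -> det3 i j k u v w = det3 i j k u' v' w'.
Proof. by move=> Eu Ev Ew; rewrite /det3 !(Eu, Ev, Ew). Qed.

Lemma eq_cubic p u u' v v' w w' :
  u =1 u' -> v =1 v' -> w =1 w' -> cubic p u v w = cubic p u' v' w'.
Proof.
by move=> Eu Ev Ew; apply: eq_bigr => t _; rewrite (eq_det3 _ _ _ Eu Ev Ew).
Qed.

Lemma cubic_suml (I : finType) p (c : I -> F) (E : I -> label -> F) v w :
  cubic p (fun x => \sum_i c i * E i x) v w = \sum_i c i * cubic p (E i) v w.
Proof.
under [RHS]eq_bigr => i _ do rewrite /cubic mulr_sumr.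
rewrite exchange_big; apply: eq_bigr => t _ /=.
under eq_bigr => i _ do rewrite mulrCA.
rewrite -mulr_sumr /det3 !mulr_suml -!big_split; congr (_ * _).
by apply: eq_bigr => i _ /=; ring.
Qed.

Lemma cubic_delta p u v w :
  cubic p u v w =
  \sum_a u a * \sum_b v b * \sum_c w c * cubic p (delta a) (delta b) (delta c).
Proof.
have step u' v' w' :
    cubic p u' v' w' = \sum_a u' a * cubic p (delta a) v' w'.
  rewrite -cubic_suml; apply: eq_cubic => // x; exact/esym/delta_sum.
rewrite step; apply: eq_bigr => a _; rewrite cubic_rot step.
congr (_ * _); apply: eq_bigr => b _; rewrite cubic_rot step.
by congr (_ * _); apply: eq_bigr => c _; rewrite cubic_rot.
Qed.

Lemma sympl_delta u v :
  sympl u v = \sum_a u a * \sum_b v b * sympl (delta a) (delta b).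
Proof.
have sC u' v' : sympl u' v' = - sympl v' u'.
  by rewrite -sumrN; apply: eq_bigr => i _; ring.
have step u' v' : sympl u' v' = \sum_a u' a * sympl (delta a) v'.
  under eq_bigr => a _ do rewrite mulr_sumr.
  rewrite exchange_big; apply: eq_bigr => i _ /=.
  rewrite -[u' (inl i)]delta_sum -[u' (inr i)]delta_sum !mulr_suml -sumrB.
  by apply: eq_bigr => a _; ring.
rewrite step; apply: eq_bigr => a _; rewrite sC step -sumrN.
by congr (_ * _); apply: eq_bigr => b _; rewrite sC; ring.
Qed.

End Coordinates.

Definition alternating3 (T : Type) (V : zmodType) (f : T -> T -> T -> V) :=
  [/\ forall a c, f a a c = 0,
      forall a b c, f a b c = - f b a c
    & forall a b c, f a b c = f b c a].

(** A presentation speaks of triples up to reordering; this reduces every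
    comparison of trilinear forms to one check per increasing triple. *)
Lemma alternating3_eq (V : zmodType) (f g : label -> label -> label -> V) :
    alternating3 f -> alternating3 g ->
    (forall a b c, (rank a < rank b < rank c)%N -> f a b c = g a b c) ->
  forall a b c, f a b c = g a b c.
Proof.
move=> [f0 fS fR] [g0 gS gR] fg.
have le_case a b c : (rank a < rank b)%N -> f a b c = g a b c.
  move=> lt_ab; have [lt_bc|lt_cb|eq_bc] := ltngtP (rank b) (rank c).
  - by apply: fg; rewrite lt_ab.
  - have [lt_ac|lt_ca|eq_ac] := ltngtP (rank a) (rank c).
    + by rewrite fR fS [RHS]gR [RHS]gS fR gR fR gR fg // lt_ac.
    + by rewrite fR fR gR gR fg // lt_ca.
    + by rewrite (rank_inj eq_ac) fR fR f0 gR gR g0.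
  - by rewrite (rank_inj eq_bc) fR f0 gR g0.
move=> a b c; have [/le_case//|lt_ba|eq_ab] := ltngtP (rank a) (rank b).
  by rewrite fS gS le_case.
by rewrite (rank_inj eq_ab) f0 g0.
Qed.

Section Keys.
Variable F : fieldType.
Implicit Types (p q : presentation F).

Definition increasing (a b c : label) := (rank a < rank b < rank c)%N.

(** The shape of a presentation for which each entry is the coefficient of its
    own minor, with no contribution from the other entries. *)
Definition increasing_keys p :=
  uniq [seq t.1 | t <- p] && all (fun t => increasing t.1.1.1 t.1.1.2 t.1.2) p.

Let delta_mul (u v w u' v' w' : label) :
  delta F u u' * (delta F v v' * delta F w w') =
    [&& u == u', v == v' & w == w']%:R.
Proof. by rewrite !deltaE -!natrM !mulnb. Qed.

(** The five other terms of the determinant would need a non-identical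
    permutation to map one increasing triple to another. *)
Lemma det3_delta i j k a b c : increasing i j k -> increasing a b c ->
  det3 i j k (delta F a) (delta F b) (delta F c) = ((a, b, c) == (i, j, k))%:R.
Proof.
rewrite /increasing => lt_ijk lt_abc; rewrite /det3 !mulrBr !delta_mul.
have -> : [&& a == i, b == k & c == j] = false.
  by apply/negP => /and3P[/eqP ? /eqP ? /eqP ?]; subst; lia.
have -> : [&& a == j, b == k & c == i] = false.
  by apply/negP => /and3P[/eqP ? /eqP ? /eqP ?]; subst; lia.
have -> : [&& a == j, b == i & c == k] = false.
  by apply/negP => /and3P[/eqP ? /eqP ? /eqP ?]; subst; lia.
have -> : [&& a == k, b == i & c == j] = false.
  by apply/negP => /and3P[/eqP ? /eqP ? /eqP ?]; subst; lia.
have -> : [&& a == k, b == j & c == i] = false.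
  by apply/negP => /and3P[/eqP ? /eqP ? /eqP ?]; subst; lia.
by rewrite !subr0 !addr0 -!pair_eqE /= andbA.
Qed.

Lemma det3_delta_perm i j k a b c : ~~ perm_eq [:: a; b; c] [:: i; j; k] ->
  det3 i j k (delta F a) (delta F b) (delta F c) = 0.
Proof.
move=> nperm; rewrite /det3 !mulrBr !delta_mul.
have no x y z : perm_eq [:: x; y; z] [:: i; j; k] ->
    [&& a == x, b == y & c == z] = false.
  by move=> eqp; apply: contraNF nperm => /and3P[/eqP-> /eqP-> /eqP->].
have rotp (x y z : label) : perm_eq [:: x; y; z] [:: y; z; x].
  by rewrite (perm_catC [:: x] [:: y; z]).
have swp (x y z : label) : perm_eq [:: x; y; z] [:: y; x; z].
  by rewrite (perm_catCA [:: x] [:: y] [:: z]).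
have p1 := swp j i k; have p2 := perm_trans (rotp k i j) (perm_refl _).
have p3 := perm_trans (rotp j k i) p2.
have p4 := perm_trans (swp k j i) p3; have p5 := perm_trans (swp i k j) p2.
by rewrite !no // !subrr !addr0.
Qed.

Lemma perm_increasing a b c i j k : increasing a b c -> increasing i j k ->
  perm_eq [:: a; b; c] [:: i; j; k] -> (a, b, c) = (i, j, k).
Proof.
move=> /andP[ab bc] /andP[ij jk] /(perm_map rank) eqp.
have []: [:: rank a; rank b; rank c] = [:: rank i; rank j; rank k].
  by apply: (sorted_eq ltn_trans) eqp => //=; rewrite ?ab ?bc ?ij ?jk //;
     move=> x y; lia.
by move=> /rank_inj-> /rank_inj-> /rank_inj->.
Qed.

Lemma cubic_delta_key p a b c z : increasing_keys p -> (a, b, c, z) \in p ->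
  cubic p (delta F a) (delta F b) (delta F c) = z.
Proof.
move=> /andP[uniq_p /allP inc_p] pz; have inc := inc_p _ pz.
have uniq_p' := map_uniq uniq_p; rewrite /cubic (bigD1_seq _ pz) //=.
rewrite det3_delta // eqxx mulr1 big_seq_cond big1 ?addr0 // => t /andP[pt nt].
rewrite det3_delta //; last exact: inc_p.
rewrite -2!surjective_pairing; case: eqP => [eq_t | _]; last by rewrite mulr0.
case/eqP: nt; case: t eq_t pt => t y /= <- pt; congr (_, _).
have in_map s : uniq [seq x.1 | x <- s] -> (a, b, c, y) \in s ->
    (a, b, c, z) \in s -> y = z :> F.
  elim: s => //= [[k x]] s IHs /= /andP[nk us].
  rewrite !inE => /orP[/eqP[Ek Ex] | ys] /orP[/eqP[Ek' Ex'] | zs].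
  - by rewrite Ex Ex'.
  - by case/negP: nk; rewrite -Ek; apply/mapP; exists (a, b, c, z).
  - by case/negP: nk; rewrite -Ek'; apply/mapP; exists (a, b, c, y).
  - exact: IHs.
exact: (in_map p).
Qed.

Lemma cubic_delta_nokey p a b c :
    (forall a' b' c' z, (a', b', c', z) \in p ->
       ~~ perm_eq [:: a; b; c] [:: a'; b'; c']) ->
  cubic p (delta F a) (delta F b) (delta F c) = 0.
Proof.
move=> no; rewrite /cubic big_seq big1 // => [[[[i j] k] z]] /no nperm.
by rewrite /= det3_delta_perm ?mulr0.
Qed.

End Keys.

(** * Standard bases and the trilinear form *)

Section TrilinearForm.
Variables (F : fieldType) (L : saa F).
Implicit Types (u v w : L) (e : label -> L).

Definition tri u v w : F := saa_form (saa_mul u v) w.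

Lemma saa_mulC u v : saa_mul u v = - saa_mul v u.
Proof.
have /eqP := saa_mul_alt (u + v).
by rewrite linearDl !linearDr !saa_mul_alt add0r addr0 addr_eq0 => /eqP.
Qed.

Lemma saa_formC u v : saa_form u v = - saa_form v u.
Proof.
have /eqP := saa_form_alt (u + v).
by rewrite linearDl !linearDr !saa_form_alt add0r addr0 addr_eq0 => /eqP.
Qed.

Lemma tri_alternating : alternating3 tri.
Proof.
split=> [u w | u v w | u v w]; rewrite /tri ?saa_mul_alt ?linear0l //.
  by rewrite saa_mulC linearNl.
exact: saa_form_mul.
Qed.

Lemma form_suml (I : finType) (c : I -> F) (E : I -> L) v :
  saa_form (\sum_i c i *: E i) v = \sum_i c i * saa_form (E i) v.
Proof.
by rewrite linear_sumlz; apply: eq_bigr => i _; rewrite linearZl_LR.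
Qed.

Lemma form_sumr (I : finType) (c : I -> F) (E : I -> L) v :
  saa_form v (\sum_i c i *: E i) = \sum_i c i * saa_form v (E i).
Proof.
by rewrite linear_sumr; apply: eq_bigr => i _; rewrite linearZr_LR.
Qed.

Lemma tri_suml (I : finType) (c : I -> F) (E : I -> L) v w :
  tri (\sum_i c i *: E i) v w = \sum_i c i * tri (E i) v w.
Proof.
rewrite /tri linear_sumlz -form_suml; congr (saa_form _ _).
by apply: eq_bigr => i _; rewrite linearZl_LR.
Qed.

Lemma tri_sum3 e (f g h : label -> F) :
  tri (\sum_a f a *: e a) (\sum_a g a *: e a) (\sum_a h a *: e a) =
  \sum_a f a * \sum_b g b * \sum_c h c * tri (e a) (e b) (e c).
Proof.
have [_ _ triR] := tri_alternating.
rewrite tri_suml; apply: eq_bigr => a _; rewrite triR tri_suml.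
congr (_ * _); apply: eq_bigr => b _; rewrite triR tri_suml.
by congr (_ * _); apply: eq_bigr => c _; rewrite triR.
Qed.

Definition dual (a : label) : label :=
  match a with inl i => inr i | inr i => inl i end.

Definition sgn (a : label) : F := if a is inl _ then 1 else -1.

Lemma sympl_delta_dual (f : label -> F) a :
  sympl f (delta F (dual a)) = sgn a * f a.
Proof.
case: a => i; rewrite /sympl /= (bigD1 i) //= !deltaE eqxx /= ?big1.
- by rewrite mulr1 mulr0 subr0 mul1r addr0.
- move=> k nik; rewrite !deltaE (inj_eq inr_inj) (eq_sym i) (negPf nik) /=.
  by rewrite !mulr0 subr0.
- by rewrite mulr0 mulr1 sub0r mulN1r addr0.
- move=> k nik; rewrite !deltaE (inj_eq inl_inj) (eq_sym i) (negPf nik) /=.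
  by rewrite !mulr0 subr0.
Qed.

Lemma sgnK a : sgn a * sgn a = 1.
Proof. by case: a => i /=; rewrite ?mulr1 ?mulrNN ?mulr1. Qed.

Lemma standard_formE e : standard_basis e ->
  forall a b, saa_form (e a) (e b) = sympl (delta F a) (delta F b).
Proof.
case=> _ exx eyy exy a b; have -> : b = dual (dual b) by case: b.
rewrite sympl_delta_dual deltaE; case: a => i; case: b => j /=.
- by rewrite exx mulr0.
- by rewrite exy mul1r (inj_eq inl_inj).
- by rewrite saa_formC exy mulN1r (inj_eq inr_inj) eq_sym.
- by rewrite eyy mulr0.
Qed.

Definition coord_in e u (a : label) : F :=
  match a with
  | inl i => saa_form u (e (inr i))
  | inr i => saa_form (e (inl i)) u
  end.

Lemma coord_inE e u a : coord_in e u a = sgn a * saa_form u (e (dual a)).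
Proof. by case: a => i /=; rewrite ?mul1r // saa_formC mulN1r. Qed.

(** Both sides have the same pairings with the basis vectors, and the form is
    non-degenerate. *)
Lemma standard_coord e u : standard_basis e -> u = \sum_a coord_in e u a *: e a.
Proof.
move=> se; have ee := standard_formE se; have [be _ _ _] := se.
apply/eqP; rewrite -subr_eq0; apply/eqP/saa_form_nondeg => v.
have be' : basis_of fullv (codom_tuple e) by [].
rewrite (coord_basis be' (memvf v)) linear_sumr big1 // => i _.
rewrite linearZr_LR /= [X in _ * X](_ : _ = 0) ?mulr0 //.
have /codomP[a ->] : (codom_tuple e)`_i \in codom e.
  by apply: mem_nth; rewrite size_codom; have := ltn_ord i; rewrite /= ?cardE.
have -> : a = dual (dual a) by case: a.
rewrite linearBl /= form_suml; under eq_bigr => b _ do rewrite ee.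
have -> : \sum_b coord_in e u b * sympl (delta F b) (delta F (dual (dual a)))
   = sgn (dual a) * coord_in e u (dual a).
  rewrite (bigD1 (dual a)) //= big1 ?addr0 => [|b nb].
    by rewrite sympl_delta_dual deltaE eqxx mulr1 mulrC.
  by rewrite sympl_delta_dual deltaE (negPf nb) !mulr0.
by rewrite coord_inE mulrA sgnK mul1r subrr.
Qed.

Lemma coord_in0 e a : coord_in e 0 a = 0.
Proof. by rewrite coord_inE linear0l mulr0. Qed.

Lemma coord_inD e u v a :
  coord_in e (u + v) a = coord_in e u a + coord_in e v a.
Proof. by rewrite !coord_inE linearDl mulrDr. Qed.

Lemma coord_inZ e k u a : coord_in e (k *: u) a = k * coord_in e u a.
Proof. by rewrite !coord_inE linearZl_LR mulrCA. Qed.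

Lemma form_coord e u v : standard_basis e ->
  saa_form u v = sympl (coord_in e u) (coord_in e v).
Proof.
move=> se; rewrite {1}(standard_coord u se) {1}(standard_coord v se).
rewrite form_suml sympl_delta; apply: eq_bigr => a _; rewrite form_sumr.
by congr (_ * _); apply: eq_bigr => b _; rewrite standard_formE.
Qed.

Lemma coord_in_basis e a : standard_basis e -> coord_in e (e a) =1 delta F a.
Proof.
move=> se b; rewrite coord_inE (standard_formE se) sympl_delta_dual mulrA.
by rewrite sgnK mul1r.
Qed.

Lemma dim_standard e : standard_basis e -> \dim {:L} = 10.
Proof.
case=> be _ _ _; have := size_basis (be : basis_of fullv (codom_tuple e)).
by rewrite card_sum card_ord.
Qed.

(** The pairing with the vector of the dual label isolates a coefficient of a
    linear combination, so vectors with the pairings of a standard basis are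
    independent. *)
Lemma standard_basisP e : \dim {:L} = 10 ->
  (forall a b, saa_form (e a) (e b) = sympl (delta F a) (delta F b)) ->
  standard_basis e.
Proof.
move=> dimL ee; split.
- have fr : free (codom_tuple e).
    apply/freeP => k sum0 i.
    have Ei (j : 'I_#|label|) : (codom_tuple e)`_j = e (enum_val j).
      by rewrite -(@nth_codom _ _ 0 e j).
    have : saa_form (\sum_j k j *: (codom_tuple e)`_j)
             (e (dual (enum_val i))) = 0.
      by rewrite sum0 linear0l.
    rewrite form_suml (bigD1 i) //= Ei ee sympl_delta_dual deltaE eqxx mulr1.
    rewrite big1 ?addr0 => [/eqP|j nij].
      by rewrite mulf_eq0 => /orP[/eqP//|]; case: enum_val => ? /=;
         rewrite ?oppr_eq0 oner_eq0.
    by rewrite Ei ee sympl_delta_dual deltaE (inj_eq enum_val_inj)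
       (negPf nij) !mulr0.
  rewrite basisEfree subvf dimL size_codom card_sum card_ord.
  by rewrite leqnn -[codom e]/(val (codom_tuple e)) fr.
- move=> i j; rewrite ee /sympl big1 // => k _.
  by rewrite !deltaE mulr0 mul0r subrr.
- move=> i j; rewrite ee /sympl big1 // => k _.
  by rewrite !deltaE mulr0 mul0r subrr.
- move=> i j; rewrite ee (sympl_delta_dual _ (inl j)) /= mul1r deltaE.
  by rewrite (inj_eq inl_inj).
Qed.

End TrilinearForm.

(** * Presentations as cubic forms *)

Section Presents.
Variable F : fieldType.
Implicit Types (p q : presentation F).

Definition presents (L : saa F) (e : label -> L) p :=
  standard_basis e /\
  forall a b c, tri (e a) (e b) (e c) =
                cubic p (delta F a) (delta F b) (delta F c).

Lemma presents_tri (L : saa F) (e : label -> L) p u v w : presents e p ->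
  tri u v w = cubic p (coord_in e u) (coord_in e v) (coord_in e w).
Proof.
case=> se ep; rewrite {1}(standard_coord u se) {1}(standard_coord v se).
rewrite {1}(standard_coord w se) tri_sum3 [RHS]cubic_delta.
by do 3![apply: eq_bigr => ? _; congr (_ * _)].
Qed.

Lemma cubic_alternating p :
  alternating3 (fun a b c => cubic p (delta F a) (delta F b) (delta F c)).
Proof.
by split=> *; [apply: cubic_alt | apply: cubic_swap | apply: cubic_rot].
Qed.

Lemma tri_basis_alternating (L : saa F) (e : label -> L) :
  alternating3 (fun a b c => tri (e a) (e b) (e c)).
Proof. by have [t0 tS tR] := tri_alternating L; split=> *; auto. Qed.

Lemma presentsP (L : saa F) (e : label -> L) p : standard_basis e ->
    (forall a b c, increasing a b c -> tri (e a) (e b) (e c) =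
       cubic p (delta F a) (delta F b) (delta F c)) ->
  presents e p.
Proof.
move=> se ep; split=> //; apply: alternating3_eq => //.
  exact: tri_basis_alternating.
exact: cubic_alternating.
Qed.

(** Alternation turns the condition on the unlisted triples, stated up to
    reordering, into the vanishing of the unlisted coefficients. *)
Lemma has_presentationP (L : saa F) p : increasing_keys p ->
  has_presentation L p <-> exists e : label -> L, presents e p.
Proof.
move=> keys_p; split=> [[e [se ep e0]] | [e [se ep]]]; exists e; last first.
  split=> // a b c => [z pz | no]; rewrite -/(tri _ _ _) ep.
    exact: cubic_delta_key.
  exact: cubic_delta_nokey.
apply: presentsP => // a b c inc_abc.
have [/mapP[[k z] pz /= Ek] | no] := boolP ((a, b, c) \in [seq t.1 | t <- p]).
  rewrite -{k}Ek in pz.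
  by rewrite /tri (ep _ _ _ _ pz) (cubic_delta_key keys_p pz).
have no' a' b' c' z :
    (a', b', c', z) \in p -> ~~ perm_eq [:: a; b; c] [:: a'; b'; c'].
  move=> pz; apply: contra no => eqp; apply/mapP; exists (a', b', c', z) => //=.
  apply: perm_increasing => //; have /andP[_ /allP inc_p] := keys_p.
  exact: inc_p pz.
by rewrite cubic_delta_nokey //; apply: e0.
Qed.

(** R expresses the coordinates in the old basis through the coordinates in the
    new one; since both forms are multilinear, comparing them in coordinates
    is one polynomial identity. *)
Lemma change_basis (L : saa F) (e : label -> L) p q
    (R : (label -> F) -> (label -> F)) :
    presents e p -> (forall u v, sympl (R u) (R v) = sympl u v) ->
    (forall u v w, cubic p (R u) (R v) (R w) = cubic q u v w) ->
  exists e' : label -> L, presents e' q.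
Proof.
move=> [se ep] symR cubR.
exists (fun a => \sum_b R (delta F a) b *: e b); split.
  apply: standard_basisP => [|a b]; first exact: dim_standard se.
  rewrite form_suml; under eq_bigr => c _.
    rewrite form_sumr; under eq_bigr => d _ do rewrite standard_formE //; over.
  by rewrite -sympl_delta symR.
move=> a b c; rewrite tri_sum3 -cubR [RHS]cubic_delta.
by do 3![apply: eq_bigr => ? _; congr (_ * _)].
Qed.

Lemma presents_isomorphic (L M : saa F) p : increasing_keys p ->
  has_presentation L p -> saa_isomorphic L M -> has_presentation M p.
Proof.
move=> keys_p /(has_presentationP _ keys_p)[e [se ep]] [f [bij_f fM fF]].
apply/(has_presentationP _ keys_p); exists (f \o e); split.
  apply: standard_basisP => [|a b]; last by rewrite /= fF standard_formE.
  have ker0 : (lker f == 0)%VS by apply/lker0P/bij_inj.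
  have img : limg f = fullv.
    apply/eqP; rewrite eqEsubv subvf; apply/subvP => v _.
    have [g _ gK] := bij_f.
    by rewrite -(gK v) memv_img ?memvf.
  by rewrite -img limg_dim_eq ?(eqP ker0) ?capv0 // (dim_standard se).
by move=> a b c; rewrite -ep /tri /= -fM fF.
Qed.

End Presents.

(** * Existence of an algebra with a given presentation *)

Section Model.
Variables (F : fieldType) (p : presentation F).

Let V : vectType F := {ffun label -> F^o}.
Implicit Types u v w : V.

Definition model_form (u v : V) : F := sympl u v.

(** The product is forced by the form: the coordinate of uv along a basis vector
    is, up to sign, the value of the trilinear form on u, v and the basis vector
    paired with it. *)
Definition model_mul (u v : V) : V :=
  [ffun a => sgn F a * cubic p u v (delta F (dual a))].

Lemma sympl_linearl (c : F) (u v w : label -> F) :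
  sympl (fun x => c * u x + v x) w = c * sympl u w + sympl v w.
Proof. by rewrite !symplE; ring. Qed.

Lemma sympl_linearr (c : F) (u v w : label -> F) :
  sympl w (fun x => c * u x + v x) = c * sympl w u + sympl w v.
Proof. by rewrite !symplE; ring. Qed.

Lemma cubic_linearl (c : F) (u v w z : label -> F) :
  cubic p (fun x => c * u x + v x) w z = c * cubic p u w z + cubic p v w z.
Proof.
by rewrite mulr_sumr -big_split; apply: eq_bigr => t _ /=; rewrite /det3; ring.
Qed.

Let addZE (c : F) u v : (c *: u + v : V) =1 (fun x => c * u x + v x).
Proof. by move=> x; rewrite !ffunE. Qed.

Let eq_sympl (u u' v v' : label -> F) :
  u =1 u' -> v =1 v' -> sympl u v = sympl u' v'.
Proof. by move=> Eu Ev; apply: eq_bigr => i _; rewrite !Eu !Ev. Qed.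

Lemma model_form_bilinear : bilinear_for *%R *%R model_form.
Proof.
split=> w c u v.
  exact: etrans (eq_sympl (addZE c u v) (frefl w)) (sympl_linearl c u v w).
exact: etrans (eq_sympl (frefl w) (addZE c u v)) (sympl_linearr c u v w).
Qed.

Lemma model_mul_bilinear : bilinear_for *:%R *:%R model_mul.
Proof.
split=> w c u v; apply/ffunP => a; rewrite !ffunE.
  have -> := eq_cubic p (addZE c u v) (frefl w) (frefl (delta F (dual a))).
  by rewrite cubic_linearl /GRing.scale /=; ring.
have -> := eq_cubic p (frefl w) (addZE c u v) (frefl (delta F (dual a))).
by rewrite cubic_swap cubic_linearl !(cubic_swap p w) /GRing.scale /=; ring.
Qed.

HB.instance Definition _ :=
  bilinear_isBilinear.Build F V V F *%R *%R model_form model_form_bilinear.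
HB.instance Definition _ :=
  bilinear_isBilinear.Build F V V V *:%R *:%R model_mul model_mul_bilinear.

Lemma model_tri u v w : model_form (model_mul u v) w = cubic p u v w.
Proof.
have -> : cubic p u v w = \sum_a w a * cubic p u v (delta F a).
  rewrite -cubic_rot; under eq_bigr => a _ do rewrite -cubic_rot.
  by rewrite -cubic_suml; apply: eq_cubic => // x; exact/esym/delta_sum.
rewrite big_sumType /= -big_split; apply: eq_bigr => i _ /=.
by rewrite !ffunE /=; ring.
Qed.

Lemma model_form_nondeg u : (forall v, model_form u v = 0) -> u = 0.
Proof.
move=> u0; apply/ffunP => a; rewrite ffunE.
have /eqP : sgn F a * u a = 0.
  rewrite -sympl_delta_dual -[RHS](u0 [ffun b => delta F (dual a) b]).
  by apply: eq_sympl => // b; rewrite ffunE.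
by rewrite mulf_eq0 => /orP[|/eqP //]; case: a => i /=;
  rewrite ?oppr_eq0 oner_eq0.
Qed.

Definition model : saa F.
Proof.
apply: (@SAA F V model_form model_mul).
- move=> u; rewrite /= /model_form /sympl big1 // => i _.
  by rewrite mulrC subrr.
- exact: model_form_nondeg.
- by move=> u; apply/ffunP => a; rewrite /= /model_mul !ffunE cubic_alt mulr0.
- by move=> u v w; rewrite /= !model_tri cubic_rot.
Defined.


Definition model_basis (a : label) : model := [ffun b => delta F a b].

Lemma model_presents : presents model_basis p.
Proof.
have basisE a : (model_basis a : V) =1 delta F a by move=> b; rewrite ffunE.
split=> [|a b c]; last first.
  by rewrite /tri /= model_tri; apply: eq_cubic.
apply: standard_basisP => [|a b]; last exact: eq_sympl.
by rewrite dimvf /dim /= card_sum card_ord.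
Qed.
End Model.

(** * Realizing the equivalences of parameters *)

Section ChangeOfParameters.
Variable F : fieldType.

Lemma P10_3_8_keys (r s : F) : increasing_keys (P10_3_8 r s).
Proof. by []. Qed.

Lemma cubic_P10_3_8 (r s : F) u v w :
  cubic (P10_3_8 r s) u v w =
    r * det3 (lx 2) (ly 4) (ly 5) u v w + s * det3 (lx 1) (ly 3) (ly 5) u v w
    + det3 (lx 1) (ly 2) (ly 4) u v w + det3 (ly 1) (ly 2) (ly 5) u v w
    + det3 (ly 1) (ly 3) (ly 4) u v w.
Proof. by rewrite /cubic !big_cons big_nil /=; ring. Qed.

(** In the algebra with parameters (r, s) the map tau sends x5 to x4 and x4 to
    s x5, so it makes L^5 a line over F(sqrt s). The new x5 is the multiple of
    the old one by the element of F(sqrt s) with coordinates x, y, and the new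
    y3, hence the new tau, is divided by its norm N, which keeps the change on
    the plane of x1, y1 of determinant 1. The factor a scales the basis vectors
    along the grading in which r alone has nonzero weight. *)
Lemma presents_rescale (L : saa F) (e : label -> L) (r s a x y : F) :
    a != 0 -> x ^+ 2 - y ^+ 2 * s != 0 -> presents e (P10_3_8 r s) ->
  exists e' : label -> L,
    presents e' (P10_3_8 (a ^+ 3 * r) (s / (x ^+ 2 - y ^+ 2 * s) ^+ 2)).
Proof.
set N := x ^+ 2 - y ^+ 2 * s => a0 N0 pe.
apply: (change_basis (R := fun u => entries
  [:: x / N * u (lx 1) + y * u (ly 1);
      a * u (lx 2);
      a * N * u (lx 3);
      x / (a * N) * u (lx 4) + y / a * u (lx 5);
      y * s / (a * N) * u (lx 4) + x / a * u (lx 5);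
      y * s / N * u (lx 1) + x * u (ly 1);
      a^-1 * u (ly 2);
      (a * N)^-1 * u (ly 3);
      a * x * u (ly 4) - a * y * s / N * u (ly 5);
      - (a * y) * u (ly 4) + a * x / N * u (ly 5)]) pe) => [u v|u v w].
  by rewrite !symplE /entries !rankE /= /N; field; rewrite -/N N0 a0.
rewrite !cubic_P10_3_8 /det3 /entries !rankE /= /N.
by field; rewrite -/N N0 a0.
Qed.

End ChangeOfParameters.

(** * The upper central series in coordinates *)

(* Explicit labels are evaluated by [rankE] and [dualE] only; unfolding them to
   ordinals would hide them from rewriting. *)
Arguments rank : simpl never.
Arguments dual : simpl never.
Arguments coord_in : simpl never.

Lemma dualE :
  ((dual (lx 1) = ly 1) * (dual (lx 2) = ly 2) * (dual (lx 3) = ly 3) *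
   (dual (lx 4) = ly 4) * (dual (lx 5) = ly 5) * (dual (ly 1) = lx 1) *
   (dual (ly 2) = lx 2) * (dual (ly 3) = lx 3) * (dual (ly 4) = lx 4) *
   (dual (ly 5) = lx 5))%type.
Proof. by []. Qed.

Section Flags.
Variables (F : fieldType) (L : saa F) (e : label -> L).
Hypothesis se : standard_basis e.
Implicit Types (u v : L).

Lemma coord_in_mul u v a :
  coord_in e (saa_mul u v) a = sgn F a * tri u v (e (dual a)).
Proof. by rewrite coord_inE. Qed.

Definition vanishes_on (S : seq label) u :=
  all (fun a => coord_in e u a == 0) S.

Lemma mul_vanishesP S u v :
  reflect (forall a, a \in S -> tri u v (e (dual a)) = 0)
          (vanishes_on S (saa_mul u v)).
Proof.
apply: (iffP allP) => [uv0 a /uv0 | uv0 a Sa]; rewrite coord_in_mul.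
  rewrite mulf_eq0 => /orP[|/eqP //].
  by case: (a) => i /=; rewrite ?oppr_eq0 oner_eq0.
by rewrite uv0 ?mulr0.
Qed.

(** Since the dual of a label is the place where the trilinear form reads a
    coordinate of a product, each term of the upper central series is cut out by
    values of the trilinear form on basis vectors. *)
Lemma ucs_step m S :
    (forall u, (u \in saa_ucs L m) = vanishes_on S u) ->
  forall u, reflect (forall a v, a \in S -> tri u v (e (dual a)) = 0)
                    (u \in saa_ucs L m.+1).
Proof.
move=> ucsE u; apply: (iffP (saa_ucsSP _ _)) => [Zu a v | Zu v].
  by have := Zu v; rewrite ucsE => /mul_vanishesP; apply.
by rewrite ucsE; apply/mul_vanishesP => a; apply: Zu.
Qed.

Definition all_labels := [:: lx 1; lx 2; lx 3; lx 4; lx 5;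
                             ly 1; ly 2; ly 3; ly 4; ly 5].

Lemma ucs0_vanishes u : (u \in saa_ucs L 0) = vanishes_on all_labels u.
Proof.
rewrite memv0; apply/eqP/idP => [-> | /allP u0].
  by apply/allP => a _; rewrite coord_inE linear0l mulr0.
rewrite (standard_coord u se) big1 // => a _.
have /u0/eqP-> : a \in all_labels by elim/label_ind: a.
by rewrite scale0r.
Qed.

End Flags.

Section FlagsOfPresentation.
Variables (F : fieldType) (L : saa F) (e : label -> L) (r s : F).
Hypotheses (pe : presents e (P10_3_8 r s)) (r0 : r != 0).
Implicit Types (u v : L).
Let se : standard_basis e := pe.1.

Let tri_vec u v c : tri u v (e c) =
  cubic (P10_3_8 r s) (coord_in e u) (coord_in e v) (delta F c).
Proof.
rewrite (presents_tri _ _ _ pe).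
by apply: eq_cubic => //; apply: coord_in_basis.
Qed.

Let tri_basis u b c : tri u (e b) (e c) =
  cubic (P10_3_8 r s) (coord_in e u) (delta F b) (delta F c).
Proof. by rewrite tri_vec; apply: eq_cubic => //; apply: coord_in_basis. Qed.

(** Every coordinate a except those along x3, x4, x5, which span the center,
    shows up, up to a nonzero factor, as the value of the trilinear form on u,
    some basis vector and the basis vector c. *)
Definition visible_at : seq (label * label) :=
  [:: (lx 1, ly 2); (lx 2, ly 5); (ly 1, ly 2); (ly 2, lx 1); (ly 3, ly 1);
      (ly 4, lx 2); (ly 5, lx 2)].

Lemma coord_visible u a c : (a, c) \in visible_at ->
  (forall v, tri u v (e c) = 0) -> coord_in e u a = 0.
Proof.
move=> ac Z; have solve b k : k != 0 ->
    cubic (P10_3_8 r s) (coord_in e u) (delta F b) (delta F c) =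
      k * coord_in e u a -> coord_in e u a = 0.
  by rewrite -tri_basis Z => /mulfI kI /esym; rewrite -[RHS](mulr0 k) => /kI.
have N1 : -1 != 0 :> F by rewrite oppr_eq0 oner_eq0.
have rN : - r != 0 by rewrite oppr_eq0.
move: ac; rewrite !inE; case/or4P=> [|||/or4P[]] /eqP[Ea Ec];
  move: solve; rewrite {Z}Ea {}Ec => solve;
  [apply: (solve (ly 4) (-1)) | apply: (solve (ly 4) r)
  |apply: (solve (ly 5) (-1)) | apply: (solve (ly 4) 1 (oner_neq0 _))
  |apply: (solve (ly 4) 1 (oner_neq0 _)) | apply: (solve (ly 5) r)
  |apply: (solve (ly 4) (-r))] => //;
  by rewrite cubic_P10_3_8 /det3 /delta !rankE /=; ring.
Qed.

(* S' is exactly the set of coordinates that obstruct being in the next term: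
   each of them is visible, and all products stay in the term cut out by S when
   they vanish. *)
Let flag_step m (S S' : seq label) :
    (forall u, (u \in saa_ucs L m) = vanishes_on e S u) ->
    all (fun a =>
      has (fun t => (t.1 == a) && (t.2 \in map dual S)) visible_at) S' ->
    (forall u v a, (forall b, b \in S' -> coord_in e u b = 0) ->
       a \in map dual S -> tri u v (e a) = 0) ->
  forall u, (u \in saa_ucs L m.+1) = vanishes_on e S' u.
Proof.
move=> ucsE /allP vis inv u.
apply/(ucs_step ucsE)/allP => [Z a /vis/hasP[[a' c]] ac /= | Z a v Sa].
  case/andP=> /eqP Ea /mapP[b Sb Ec]; rewrite -Ea; apply/eqP.
  by apply: (coord_visible ac) => v; rewrite Ec Z.
by apply: inv => [b /Z/eqP // | ]; apply: map_f.
Qed.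

Lemma ucs1_vanishes u : (u \in saa_ucs L 1) =
  vanishes_on e [:: lx 1; lx 2; ly 1; ly 2; ly 3; ly 4; ly 5] u.
Proof.
apply: (flag_step (ucs0_vanishes se)) u => // u v a Z _.
rewrite tri_vec cubic_P10_3_8 /det3.
by rewrite (Z (lx 1)) // (Z (lx 2)) // (Z (ly 1)) // (Z (ly 2)) //
  (Z (ly 3)) // (Z (ly 4)) // (Z (ly 5)) //; ring.
Qed.

Lemma ucs2_vanishes u : (u \in saa_ucs L 2) =
  vanishes_on e [:: lx 1; ly 1; ly 2; ly 3; ly 4; ly 5] u.
Proof.
apply: (flag_step ucs1_vanishes) u => // u v a Z.
rewrite tri_vec cubic_P10_3_8 /det3.
rewrite (Z (lx 1)) // (Z (ly 1)) // (Z (ly 2)) // (Z (ly 3)) // (Z (ly 4)) //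
  (Z (ly 5)) //.
by elim/label_ind: a => // _; rewrite /delta !rankE /=; ring.
Qed.

Lemma ucs3_vanishes u : (u \in saa_ucs L 3) =
  vanishes_on e [:: ly 2; ly 3; ly 4; ly 5] u.
Proof.
apply: (flag_step ucs2_vanishes) u => // u v a Z.
rewrite tri_vec cubic_P10_3_8 /det3.
rewrite (Z (ly 2)) // (Z (ly 3)) // (Z (ly 4)) // (Z (ly 5)) //.
by elim/label_ind: a => // _; rewrite /delta !rankE /=; ring.
Qed.

Lemma ucs4_vanishes u : (u \in saa_ucs L 4) = vanishes_on e [:: ly 4; ly 5] u.
Proof.
apply: (flag_step ucs3_vanishes) u => // u v a Z.
rewrite tri_vec cubic_P10_3_8 /det3 (Z (ly 4)) // (Z (ly 5)) //.
by elim/label_ind: a => // _; rewrite /delta !rankE /=; ring.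
Qed.

End FlagsOfPresentation.

(** * The parameters as invariants *)

Section Invariants.
Variables (F : fieldType) (charF : 2%N \notin [pchar F]).

(** Here k, l and m are the factors by which x2, y2 and y3 change modulo lower
    terms, n is the part of the new y3 along y2, and the matrices (a b; c d) and
    (p q; t w) describe x1, y1 and y4, y5. The equations for phi say that the
    second matrix is k times the inverse transpose of the first. Those for psi
    force n = 0, since 2n = 0, and make (Na Nb; c d) the matrix of
    multiplication by d + c sqrt s, where N = d^2 - c^2 s is the norm of this
    element. *)
Lemma parameters_of_block (r s r' s' a b c d k l m n p q t w : F) :
    a * d - b * c = 1 -> k * l = 1 ->
    l * (a * p + b * q) = 1 -> l * (a * t + b * w) = 0 ->
    l * (c * p + d * q) = 0 -> l * (c * t + d * w) = 1 ->
    m * (s * a * q + b * p) + n * (a * p + b * q) = 0 ->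
    m * (s * a * w + b * t) + n * (a * t + b * w) = s' ->
    m * (s * c * q + d * p) + n * (c * p + d * q) = 1 ->
    m * (s * c * w + d * t) + n * (c * t + d * w) = 0 ->
    k * r * (p * w - q * t) = r' ->
  [/\ k != 0, r' = k ^+ 3 * r, d ^+ 2 - c ^+ 2 * s != 0
    & s = s' * (d ^+ 2 - c ^+ 2 * s) ^+ 2].
Proof.
move=> det1 kl E1 E2 E3 E4 G1 G2 G3 G4 <-.
have k0 : k != 0.
  by apply/eqP => k0; move/eqP: kl; rewrite k0 mul0r eq_sym oner_eq0.
have two0 : 2%:R != 0 :> F by apply: contra charF => z; apply/andP.
have scale z z' : l * z = z' -> z = k * z' by move=> <-; rewrite mulrA kl mul1r.
have Ep : p = k * d.
  apply: scale; rewrite -[LHS]mulr1 -det1.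
  by rewrite (_ : _ * _ =
      d * (l * (a * p + b * q)) - b * (l * (c * p + d * q)));
    [rewrite E1 E3; ring | ring].
have Eq : q = k * - c.
  apply: scale; rewrite -[LHS]mulr1 -det1.
  by rewrite (_ : _ * _ =
      a * (l * (c * p + d * q)) - c * (l * (a * p + b * q)));
    [rewrite E1 E3; ring | ring].
have Et : t = k * - b.
  apply: scale; rewrite -[LHS]mulr1 -det1.
  by rewrite (_ : _ * _ =
      d * (l * (a * t + b * w)) - b * (l * (c * t + d * w)));
    [rewrite E2 E4; ring | ring].
have Ew : w = k * a.
  apply: scale; rewrite -[LHS]mulr1 -det1.
  by rewrite (_ : _ * _ =
      a * (l * (c * t + d * w)) - c * (l * (a * t + b * w)));
    [rewrite E2 E4; ring | ring].
have n0 : n = 0.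
  have : 2%:R * (n * k * (a * d - b * c)) = 0.
    by rewrite -[RHS]addr0 -{1}G1 -G4 Ep Eq Et Ew; ring.
  rewrite det1 mulr1 => /eqP; rewrite !mulf_eq0 (negPf two0) (negPf k0) orbF.
  by move/eqP.
set N := d ^+ 2 - c ^+ 2 * s; pose h := m * k.
have hN : h * N = 1 by rewrite -G3 n0 Ep Eq /h /N; ring.
have N0 : N != 0.
  by apply/eqP => z; move/eqP: hN; rewrite z mulr0 eq_sym oner_eq0.
have h0 : h != 0.
  by apply/eqP => z; move/eqP: hN; rewrite z mul0r eq_sym oner_eq0.
have acs : b * d = a * c * s.
  apply/eqP; rewrite -subr_eq0 -(mulrI_eq0 _ (mulfI h0)); apply/eqP.
  by rewrite -G1 n0 Ep Eq /h; ring.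
have aN : a * N = d.
  rewrite -[RHS]mulr1 -det1 /N.
  have -> : a * (d ^+ 2 - c ^+ 2 * s) = a * d * d - c * (a * c * s) by ring.
  by rewrite -acs; ring.
have bN : b * N = c * s.
  rewrite -[RHS]mulr1 -det1 /N.
  have -> : b * (d ^+ 2 - c ^+ 2 * s) = b * d * d - b * c * (c * s) by ring.
  by rewrite acs; ring.
split=> //.
  by rewrite Ep Eq Et Ew -[RHS]mulr1 -det1; ring.
have -> : s' = h * (s * a ^+ 2 - b ^+ 2) by rewrite -G2 n0 Et Ew /h; ring.
rewrite (_ : _ * _ = h * (s * (a * N) ^+ 2 - (b * N) ^+ 2)); last by ring.
by rewrite aN bN -[LHS]mul1r -hN /N; ring.
Qed.

(** Both bases are compatible with the upper central series, whose terms depend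
    on the algebra only; y2 is compatible with the orthogonal of the center.
    This gives the zero coordinates that reduce the comparison of the two cubic
    forms to the equations of [parameters_of_block]. *)
Lemma parameters_invariant (L : saa F) (e e' : label -> L) (r s r' s' : F) :
    r != 0 -> r' != 0 ->
    presents e (P10_3_8 r s) -> presents e' (P10_3_8 r' s') ->
  exists k x y : F, [/\ k != 0, r' = k ^+ 3 * r, x ^+ 2 - y ^+ 2 * s != 0
    & s = s' * (x ^+ 2 - y ^+ 2 * s) ^+ 2].
Proof.
move=> r0 r'0 pe pe'; have [se _] := pe; have [se' pe'0] := pe'.
pose g a b := coord_in e (e' a) b.
have triE a b c : cubic (P10_3_8 r s) (g a) (g b) (g c) =
    cubic (P10_3_8 r' s') (delta F a) (delta F b) (delta F c).
  by rewrite -pe'0 (presents_tri _ _ _ pe).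
have symE a b : sympl (g a) (g b) = sympl (delta F a) (delta F b).
  by rewrite -form_coord // standard_formE.
have van S a : a \notin S -> vanishes_on e' S (e' a).
  move=> Sa; apply/allP => b Sb; rewrite coord_in_basis // deltaE.
  by have [Eab | _] := eqVneq a b; [rewrite Eab Sb in Sa | exact: eqxx].
have z1 b : b \in [:: lx 1; ly 1; ly 2; ly 3; ly 4; ly 5] -> g (lx 2) b = 0.
  have : e' (lx 2) \in saa_ucs L 2 by rewrite (ucs2_vanishes pe') // van.
  by rewrite (ucs2_vanishes pe) // => /allP H /H/eqP.
have z2 a b : a \in [:: lx 1; ly 1] -> b \in [:: ly 2; ly 3; ly 4; ly 5] ->
    g a b = 0.
  move=> a1; have : e' a \in saa_ucs L 3.
    by rewrite (ucs3_vanishes pe') // van //; move: a1; elim/label_ind: a.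
  by rewrite (ucs3_vanishes pe) // => /allP H /H/eqP.
have z3 b : b \in [:: ly 4; ly 5] -> g (ly 3) b = 0.
  have : e' (ly 3) \in saa_ucs L 4 by rewrite (ucs4_vanishes pe') // van.
  by rewrite (ucs4_vanishes pe) // => /allP H /H/eqP.
(* y2 is orthogonal to the center, which contains x3, x4 and x5. *)
have z4 b : b \in [:: ly 3; ly 4; ly 5] -> g (ly 2) b = 0.
  move=> b3; have : e (dual b) \in saa_ucs L 1.
    rewrite (ucs1_vanishes pe) //; apply/allP => a; rewrite coord_in_basis //.
    by move: b3; elim/label_ind: b => // _; elim/label_ind: a.
  rewrite (ucs1_vanishes pe') // => /allP/(_ (lx 2) isT).
  rewrite coord_inE mulf_eq0 /= oner_eq0 /= => /eqP Z.
  by rewrite /g coord_inE saa_formC Z oppr0 mulr0.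
clearbody g.
have sym1 := symE (lx 1) (ly 1); have sym2 := symE (lx 2) (ly 2).
have T1 := triE (lx 1) (ly 2) (ly 4); have T2 := triE (lx 1) (ly 2) (ly 5).
have T3 := triE (ly 1) (ly 2) (ly 4); have T4 := triE (ly 1) (ly 2) (ly 5).
have U1 := triE (lx 1) (ly 3) (ly 4); have U2 := triE (lx 1) (ly 3) (ly 5).
have U3 := triE (ly 1) (ly 3) (ly 4); have U4 := triE (ly 1) (ly 3) (ly 5).
have V := triE (lx 2) (ly 4) (ly 5).
move: sym1 sym2 T1 T2 T3 T4 U1 U2 U3 U4 V.
rewrite !symplE !cubic_P10_3_8 /det3 /delta !rankE /=.
rewrite !(z1 (lx 1) isT) !(z1 (ly 1) isT) !(z1 (ly 2) isT) !(z1 (ly 3) isT)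
  !(z1 (ly 4) isT) !(z1 (ly 5) isT) !(z2 (lx 1) (ly 2) isT isT)
  !(z2 (lx 1) (ly 3) isT isT) !(z2 (lx 1) (ly 4) isT isT)
  !(z2 (lx 1) (ly 5) isT isT) !(z2 (ly 1) (ly 2) isT isT)
  !(z2 (ly 1) (ly 3) isT isT) !(z2 (ly 1) (ly 4) isT isT)
  !(z2 (ly 1) (ly 5) isT isT) !(z3 (ly 4) isT) !(z3 (ly 5) isT)
  !(z4 (ly 3) isT) !(z4 (ly 4) isT) !(z4 (ly 5) isT).
move=> sym1 sym2 T1 T2 T3 T4 U1 U2 U3 U4 V.
exists (g (lx 2) (lx 2)), (g (ly 1) (ly 1)), (g (ly 1) (lx 1)).
apply: (parameters_of_block (a := g (lx 1) (lx 1)) (b := g (lx 1) (ly 1))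
 (l := g (ly 2) (ly 2)) (m := g (ly 3) (ly 3)) (n := g (ly 3) (ly 2))
 (p := g (ly 4) (ly 4)) (q := g (ly 4) (ly 5))
 (t := g (ly 5) (ly 4)) (w := g (ly 5) (ly 5))).
- by apply: (etrans (etrans _ sym1)); ring.
- by apply: (etrans (etrans _ sym2)); ring.
- by apply: (etrans (etrans _ T1)); ring.
- by apply: (etrans (etrans _ T2)); ring.
- by apply: (etrans (etrans _ T3)); ring.
- by apply: (etrans (etrans _ T4)); ring.
- by apply: (etrans (etrans _ U1)); ring.
- by apply: (etrans (etrans _ U2)); ring.
- by apply: (etrans (etrans _ U3)); ring.
- by apply: (etrans (etrans _ U4)); ring.
- by apply: (etrans (etrans _ V)); ring.
Qed.

Lemma norm_neq0 (s x y : F) : ~ is_square s -> (x, y) != (0, 0) ->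
  x ^+ 2 - y ^+ 2 * s != 0.
Proof.
move=> nsq; apply: contra; rewrite subr_eq0 => /eqP xys.
have [y0 | y0] := eqVneq y 0.
  move/eqP: xys; rewrite y0 expr0n mul0r expf_eq0 /= => /eqP->.
  by rewrite eqxx.
case: nsq; exists (x / y); rewrite expr_div_n xys mulrAC mulfV ?mul1r //.
by rewrite expf_neq0.
Qed.

Lemma same_algebraP (r s r' s' : F) : admissible r s -> admissible r' s' ->
  same_algebra (P10_3_8 r' s') (P10_3_8 r s) <->
  is_nonzero_cube (r' / r) /\ inG s (s / s').
Proof.
move=> [r0 nsq_s] [r'0 nsq_s'].
have s'0 : s' != 0.
  by apply/eqP => z; case: nsq_s'; exists 0; rewrite z expr0n.
split=> [[L [M [Lp' Mp isoLM]]] | [[k k0 Ek] [x [y [xy0 EG]]]]].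
  have [e' pe'] := (has_presentationP M (P10_3_8_keys r' s')).1
    (presents_isomorphic (P10_3_8_keys r' s') Lp' isoLM).
  have [e pe] := (has_presentationP M (P10_3_8_keys r s)).1 Mp.
  have [k [x [y [k0 Er N0 Es]]]] := parameters_invariant r0 r'0 pe pe'.
  split; first by exists k => //; rewrite Er mulfK.
  exists x, y; split; last by rewrite {1}Es mulrC mulKf.
  by apply: contra N0 => /eqP[-> ->]; rewrite !expr0n mul0r subrr.
have N0 := norm_neq0 nsq_s xy0.
have pm := model_presents (P10_3_8 r s).
have [e' pe'] := presents_rescale k0 N0 pm.
have Er : k ^+ 3 * r = r' by rewrite -Ek divfK.
have Es : s / (x ^+ 2 - y ^+ 2 * s) ^+ 2 = s'.
  have s0 : s != 0 by apply/eqP => z; case: nsq_s; exists 0; rewrite z expr0n.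
  by rewrite -EG invf_div mulrC divfK.
rewrite Er Es in pe'; exists (model (P10_3_8 r s)), (model (P10_3_8 r s)).
split; first by apply/(has_presentationP _ (P10_3_8_keys r' s')); exists e'.
- apply/(has_presentationP _ (P10_3_8_keys r s)).
  by exists (model_basis (P10_3_8 r s)).
- exists \1%VF; split=> [|u v|u v]; rewrite ?id_lfunE //.
  by exists id => u; rewrite id_lfunE.
Qed.

End Invariants.

(** * Reduction to the normal form *)

Section Reduction.
Variable F : fieldType.

(** The fifteen triples left by the central series and by L^3 L^2 = L^5: p and q
    are the entries of phi, a to d those of psi. *)
Definition P_general (r p1 p2 q1 q2 a b c d k1 k2 k3 k4 k5 k6 : F) :
    presentation F :=
  [:: (lx 2, ly 4, ly 5, r);
      (lx 1, ly 2, ly 4, p1); (lx 1, ly 2, ly 5, p2);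
      (ly 1, ly 2, ly 4, q1); (ly 1, ly 2, ly 5, q2);
      (lx 1, ly 3, ly 4, a); (lx 1, ly 3, ly 5, b);
      (ly 1, ly 3, ly 4, c); (ly 1, ly 3, ly 5, d);
      (lx 1, ly 4, ly 5, k1); (ly 1, ly 4, ly 5, k2);
      (ly 2, ly 4, ly 5, k3); (ly 3, ly 4, ly 5, k4);
      (ly 2, ly 3, ly 4, k5); (ly 2, ly 3, ly 5, k6)].

Lemma cubic_P_general (r p1 p2 q1 q2 a b c d k1 k2 k3 k4 k5 k6 : F) u v w :
  cubic (P_general r p1 p2 q1 q2 a b c d k1 k2 k3 k4 k5 k6) u v w =
    r * det3 (lx 2) (ly 4) (ly 5) u v w
    + (p1 * det3 (lx 1) (ly 2) (ly 4) u v w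
       + p2 * det3 (lx 1) (ly 2) (ly 5) u v w)
    + (q1 * det3 (ly 1) (ly 2) (ly 4) u v w
       + q2 * det3 (ly 1) (ly 2) (ly 5) u v w)
    + (a * det3 (lx 1) (ly 3) (ly 4) u v w
       + b * det3 (lx 1) (ly 3) (ly 5) u v w)
    + (c * det3 (ly 1) (ly 3) (ly 4) u v w
       + d * det3 (ly 1) (ly 3) (ly 5) u v w)
    + (k1 * det3 (lx 1) (ly 4) (ly 5) u v w
       + k2 * det3 (ly 1) (ly 4) (ly 5) u v w)
    + (k3 * det3 (ly 2) (ly 4) (ly 5) u v w
       + k4 * det3 (ly 3) (ly 4) (ly 5) u v w)
    + (k5 * det3 (ly 2) (ly 3) (ly 4) u v w
       + k6 * det3 (ly 2) (ly 3) (ly 5) u v w).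
Proof. by rewrite /cubic !big_cons big_nil /= addr0 !addrA. Qed.

Variable L : saa F.

(** The new x4 and x5 are x1 y2 and y1 y2, so that phi becomes the identity
    matrix; y4 and y5 change by the inverse transpose. *)
Lemma normalize_phi (e : label -> L)
    (r p1 p2 q1 q2 a b c d k1 k2 k3 k4 k5 k6 : F) (D := p1 * q2 - p2 * q1) :
    D != 0 ->
    presents e (P_general r p1 p2 q1 q2 a b c d k1 k2 k3 k4 k5 k6) ->
  exists e' : label -> L, presents e'
    (P_general (r / D) 1 0 0 1
       ((a * q2 - b * q1) / D) ((b * p1 - a * p2) / D)
       ((c * q2 - d * q1) / D) ((d * p1 - c * p2) / D)
       (k1 / D) (k2 / D) (k3 / D) (k4 / D)
       ((k5 * q2 - k6 * q1) / D) ((k6 * p1 - k5 * p2) / D)).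
Proof.
move=> D0 pe; apply: (change_basis (R := fun u => entries
  [:: u (lx 1); u (lx 2); u (lx 3);
      p1 * u (lx 4) + q1 * u (lx 5); p2 * u (lx 4) + q2 * u (lx 5);
      u (ly 1); u (ly 2); u (ly 3);
      (q2 * u (ly 4) - p2 * u (ly 5)) / D;
      (p1 * u (ly 5) - q1 * u (ly 4)) / D]) pe) => [u v|u v w].
  by rewrite !symplE /entries !rankE /= /D; field; rewrite -/D.
rewrite !cubic_P_general /det3 /entries !rankE /= /D.
by field; rewrite -/D.
Qed.

(** Subtracting t y2 from y3 makes psi traceless, with square h^2 + bc. Once y3
    is divided by c, a multiple of y1 is subtracted from x1 to make psi send y1
    to the new x4; psi is then the companion matrix of t^2 - s with
    s = (h^2 + bc) / c^2. *)
Lemma normalize_psi (e : label -> L) (r a b c d k1 k2 k3 k4 k5 k6 : F)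
    (t := (a + d) / 2%:R) (h := (a - d) / 2%:R) :
    2%:R != 0 :> F -> c != 0 ->
    presents e (P_general r 1 0 0 1 a b c d k1 k2 k3 k4 k5 k6) ->
  exists e' : label -> L, presents e'
    (P_general r 1 0 0 1 0 ((h ^+ 2 + b * c) / c ^+ 2) 1 0
       (k1 - h / c * k2) k2 k3 ((k4 - t * k3) / c)
       (k5 / c) ((k6 + h / c * k5) / c)).
Proof.
move=> two0 c0 pe; apply: (change_basis (R := fun u => entries
  [:: u (lx 1); u (lx 2); t * u (lx 2) + c * u (lx 3); u (lx 4);
      u (lx 5) - h / c * u (lx 4);
      u (ly 1) - h / c * u (lx 1); u (ly 2) - t / c * u (ly 3); u (ly 3) / c;
      u (ly 4) + h / c * u (ly 5); u (ly 5)]) pe) => [u v|u v w].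
  by rewrite !symplE /entries !rankE /= /t /h; field; rewrite c0 two0.
rewrite !cubic_P_general /det3 /entries !rankE /= /t /h.
by field; rewrite c0 two0.
Qed.

(** As r != 0, adding multiples of x2 to x1, y1, y2 and y3 removes the values at
    the triples with y4, y5; adding multiples of x1 and y1 to y3 removes those
    at the triples with y2, y3. The other coefficients keep the basis
    standard. *)
Lemma normalize_rest (e : label -> L) (r s k1 k2 k3 k4 k5 k6 : F) :
    r != 0 ->
    presents e (P_general r 1 0 0 1 0 s 1 0 k1 k2 k3 k4 k5 k6) ->
  exists e' : label -> L, presents e' (P10_3_8 r s).
Proof.
pose al := - (k1 / r); pose be := - (k2 / r); pose ga := - k6 - be * s.
pose de := k5 - al; pose c2 := - (k3 / r).
pose c4 := - ((k4 - ga * k2 + de * k1) / r).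
pose c3 := c4 - al * de + be * ga.
move=> r0 pe; apply: (change_basis (R := fun u => entries
  [:: u (lx 1) + be * u (ly 2) + de * u (ly 3);
      u (lx 2) + al * u (lx 1) + be * u (ly 1) + c2 * u (ly 2) + c4 * u (ly 3);
      u (lx 3) + ga * u (lx 1) + de * u (ly 1) + c3 * u (ly 2);
      u (lx 4); u (lx 5);
      u (ly 1) - al * u (ly 2) - ga * u (ly 3);
      u (ly 2); u (ly 3); u (ly 4); u (ly 5)]) pe) => [u v|u v w].
  by rewrite !symplE /entries !rankE /= /c3; ring.
rewrite cubic_P_general cubic_P10_3_8 /det3 /entries !rankE /=.
by rewrite /c4 /c2 /de /ga /be /al; field.
Qed.

End Reduction.

(** * Adapted bases *)

Section Expansion.
Variables (F : fieldType) (L : saa F) (e : label -> L).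
Hypothesis se : standard_basis e.

Lemma presents_of_keys (K : seq (label * label * label)) : uniq K ->
    all (fun k => increasing k.1.1 k.1.2 k.2) K ->
    (forall a b c, increasing a b c -> (a, b, c) \notin K ->
       tri (e a) (e b) (e c) = 0) ->
  presents e [seq (k, tri (e k.1.1) (e k.1.2) (e k.2)) | k <- K].
Proof.
move=> uniqK incK tri0; set p := map _ K.
have keys_p : increasing_keys p.
  by rewrite /increasing_keys -map_comp map_id_in // uniqK all_map.
apply: presentsP => // a b c inc; have [Kabc|nK] := boolP ((a, b, c) \in K).
  by rewrite (cubic_delta_key keys_p (z := tri (e a) (e b) (e c))) //;
     apply/mapP; exists (a, b, c).
rewrite tri0 // cubic_delta_nokey // => a' b' c' z /mapP[[[i j] k] Kijk].
case=> -> -> -> _; apply: contra nK => /perm_increasing -> //.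
exact: (allP incK _ Kijk).
Qed.

Lemma vanishes_addv_line (U : {vspace L}) b S u : b \notin S ->
    (forall v, v \in U -> vanishes_on e S v) ->
  u \in (U + <[e b]>)%VS -> vanishes_on e S u.
Proof.
move=> nSb Uvan /memv_addP[v Uv [_ /vlineP[k ->] ->]]; apply/allP => a Sa.
rewrite coord_inD coord_inZ coord_in_basis // (eqP (allP (Uvan v Uv) a Sa)).
rewrite add0r deltaE; have [Eb|_] := eqVneq b a; last by rewrite mulr0.
by rewrite Eb Sa in nSb.
Qed.

Lemma vanishes_mem (U : {vspace L}) S u :
  (forall a, (a \in S) || (e a \in U)) -> vanishes_on e S u -> u \in U.
Proof.
move=> SU /allP u0; rewrite (standard_coord u se) rpred_sum // => a _.
case/orP: (SU a) => [/u0/eqP-> | Ua]; first by rewrite scale0r rpred0.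
exact: rpredZ.
Qed.

End Expansion.

(** An eigenvalue gives a linear factor of the minimal polynomial. *)
Lemma irreducible_minpoly_scalar (F : fieldType) n (A : 'M[F]_n.+1) z :
  irreducible_poly (mxminpoly A) -> \det (A - z%:M) = 0 -> A = z%:M.
Proof.
move=> [_ irr] detz.
have eig : eigenvalue A z.
  apply/eigenvalueP.
  have /det0P[v v0 vA] : \det (A - z%:M) == 0 by rewrite detz.
  exists v => //; apply/eqP; rewrite -subr_eq0 -mul_mx_scalar -mulmxBr.
  by rewrite vA.
rewrite eigenvalue_root_min -dvdp_XsubCl in eig.
have : 'X - z%:P == mxminpoly A.
  rewrite -eqp_monic ?monicXsubC ?mxminpoly_monic //; apply: irr eig.
  by rewrite size_XsubC.
move=> /eqP minE; have := mx_root_minpoly A; rewrite -minE.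
by rewrite rmorphB /= horner_mx_X horner_mx_C => /eqP; rewrite subr_eq0 => /eqP.
Qed.

Definition mx2 (F : fieldType) (k l m n : F) : 'M[F]_2 :=
  \matrix_(i < 2, j < 2) nth 0 (nth [::] [:: [:: k; l]; [:: m; n]] i) j.

Lemma det_mx2 (F : fieldType) (k l m n : F) :
  \det (mx2 k l m n) = k * n - l * m.
Proof.
rewrite (expand_det_row _ ord0) !big_ord_recl big_ord0 /cofactor !det_mx11.
by rewrite !mxE /=; ring.
Qed.

Section Adapted.
Variables (F : fieldType) (L : saa F) (e : label -> L).
Hypothesis ae : adapted_basis e.
Hypothesis L32 : saa_prodv (saa_lcs L 3) (saa_lcs L 2) = saa_lcs L 5.

Let se : standard_basis e. Proof. by case: ae. Qed.

Let L5E : saa_lcs L 5 = (<[e (lx 5)]> + <[e (lx 4)]>)%VS.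
Proof. by case: ae. Qed.
Let Z1E : saa_ucs L 1 = (saa_lcs L 5 + <[e (lx 3)]>)%VS.
Proof. by case: ae. Qed.
Let Z2E : saa_ucs L 2 = (saa_ucs L 1 + <[e (lx 2)]>)%VS.
Proof. by case: ae => _ _ _ [<-]. Qed.
Let Z3L : saa_lcs L 3 = saa_ucs L 3.
Proof. by case: ae => _ _ _ []. Qed.
Let Z3E : saa_ucs L 3 = (saa_ucs L 2 + <[e (lx 1)]> + <[e (ly 1)]>)%VS.
Proof. by case: ae => _ _ _ [<- _ <-]. Qed.
Let L2E : saa_lcs L 2 = (saa_ucs L 3 + <[e (ly 2)]>)%VS.
Proof. by case: ae => _ _ _ [_ _ <- _ []]. Qed.
Let Z4E : saa_ucs L 4 = (saa_lcs L 2 + <[e (ly 3)]>)%VS.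
Proof. by case: ae => _ _ _ [_ _ _ _ []]. Qed.

Let L5_vanish u : u \in saa_lcs L 5 ->
  vanishes_on e [:: lx 1; lx 2; lx 3; ly 1; ly 2; ly 3; ly 4; ly 5] u.
Proof.
rewrite L5E -[<[e (lx 5)]>%VS]add0v.
by do 2!(apply: vanishes_addv_line => // {}u);
   rewrite memv0 => /eqP->; apply/allP => a _; rewrite coord_in0.
Qed.

Let sub_vanish (S S' : seq label) u :
  {subset S' <= S} -> vanishes_on e S u -> vanishes_on e S' u.
Proof. by move=> sS /allP H; apply/allP => a /sS/H. Qed.

Let Z1_vanish u : u \in saa_ucs L 1 ->
  vanishes_on e [:: lx 1; lx 2; ly 1; ly 2; ly 3; ly 4; ly 5] u.
Proof.
rewrite Z1E; apply: vanishes_addv_line => // v /L5_vanish.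
by apply: sub_vanish; apply/allP.
Qed.

Let Z2_vanish u : u \in saa_ucs L 2 ->
  vanishes_on e [:: lx 1; ly 1; ly 2; ly 3; ly 4; ly 5] u.
Proof.
rewrite Z2E; apply: vanishes_addv_line => // v /Z1_vanish.
by apply: sub_vanish; apply/allP.
Qed.

Let Z3_vanish u : u \in saa_ucs L 3 ->
  vanishes_on e [:: ly 2; ly 3; ly 4; ly 5] u.
Proof.
rewrite Z3E; do 2!(apply: vanishes_addv_line => // {}u); move=> /Z2_vanish.
by apply: sub_vanish; apply/allP.
Qed.

Let L2_vanish u : u \in saa_lcs L 2 ->
  vanishes_on e [:: ly 3; ly 4; ly 5] u.
Proof.
rewrite L2E; apply: vanishes_addv_line => // v /Z3_vanish.
by apply: sub_vanish; apply/allP.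
Qed.

Let memv_adds (U V : {vspace L}) u : u \in U -> u \in (U + V)%VS.
Proof. by apply/subvP/addvSl. Qed.

Let memv_addl (U : {vspace L}) u : u \in (U + <[u]>)%VS.
Proof. by apply: (subvP (addvSr _ _)); apply: memv_line. Qed.

Let x3_Z1 : e (lx 3) \in saa_ucs L 1. Proof. by rewrite Z1E memv_addl. Qed.
Let x4_Z1 : e (lx 4) \in saa_ucs L 1.
Proof. by rewrite Z1E L5E memv_adds // memv_addl. Qed.
Let x5_Z1 : e (lx 5) \in saa_ucs L 1.
Proof. by rewrite Z1E L5E !memv_adds // memv_line. Qed.
Let x2_Z2 : e (lx 2) \in saa_ucs L 2. Proof. by rewrite Z2E memv_addl. Qed.
Let x1_Z3 : e (lx 1) \in saa_ucs L 3.
Proof. by rewrite Z3E memv_adds // memv_addl. Qed.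
Let y1_Z3 : e (ly 1) \in saa_ucs L 3. Proof. by rewrite Z3E memv_addl. Qed.
Let y2_L2 : e (ly 2) \in saa_lcs L 2. Proof. by rewrite L2E memv_addl. Qed.
Let y3_Z4 : e (ly 3) \in saa_ucs L 4. Proof. by rewrite Z4E memv_addl. Qed.

Let tri_Z1 z v w : z \in saa_ucs L 1 -> tri z v w = 0.
Proof.
move=> /saa_ucsSP/(_ v); rewrite memv0 => /eqP zv.
by rewrite /tri zv linear0l.
Qed.

Let tri_Z2 z v a : z \in saa_ucs L 2 ->
  a \in [:: lx 1; lx 2; ly 1; ly 2; ly 3; ly 4; ly 5] ->
  tri z v (e (dual a)) = 0.
Proof. by move=> /saa_ucsSP/(_ v)/Z1_vanish/mul_vanishesP; apply. Qed.

Let tri_Z3 z v a : z \in saa_ucs L 3 ->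
  a \in [:: lx 1; ly 1; ly 2; ly 3; ly 4; ly 5] -> tri z v (e (dual a)) = 0.
Proof. by move=> /saa_ucsSP/(_ v)/Z2_vanish/mul_vanishesP; apply. Qed.

Let tri_Z4 z v a : z \in saa_ucs L 4 ->
  a \in [:: ly 2; ly 3; ly 4; ly 5] -> tri z v (e (dual a)) = 0.
Proof. by move=> /saa_ucsSP/(_ v)/Z3_vanish/mul_vanishesP; apply. Qed.

Let L32_vanish u v : u \in saa_ucs L 3 -> v \in saa_lcs L 2 ->
  vanishes_on e [:: lx 1; lx 2; lx 3; ly 1; ly 2; ly 3; ly 4; ly 5]
    (saa_mul u v).
Proof.
move=> Uu Vv; apply: L5_vanish; rewrite -L32.
have /saa_prodvP := subvv (saa_prodv (saa_lcs L 3) (saa_lcs L 2)).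
by apply; rewrite ?Z3L.
Qed.

Let nonzero_triples : seq (label * label * label) :=
  [seq t.1 | t <- P_general (0 : F) 0 0 0 0 0 0 0 0 0 0 0 0 0 0].

(** A vector of Z_(m+1) has its products in Z_m, hence kills, in the trilinear
    form, every basis vector orthogonal to Z_m. With Z_1, ..., Z_4 this accounts
    for all triples but x1 y2 y3 and y1 y2 y3, where the form vanishes because
    L^3 L^2 = L^5 is orthogonal to y3. *)
Lemma adapted_presents : let T a b c := tri (e a) (e b) (e c) in
  presents e (P_general (T (lx 2) (ly 4) (ly 5))
    (T (lx 1) (ly 2) (ly 4)) (T (lx 1) (ly 2) (ly 5))
    (T (ly 1) (ly 2) (ly 4)) (T (ly 1) (ly 2) (ly 5))
    (T (lx 1) (ly 3) (ly 4)) (T (lx 1) (ly 3) (ly 5))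
    (T (ly 1) (ly 3) (ly 4)) (T (ly 1) (ly 3) (ly 5))
    (T (lx 1) (ly 4) (ly 5)) (T (ly 1) (ly 4) (ly 5))
    (T (ly 2) (ly 4) (ly 5)) (T (ly 3) (ly 4) (ly 5))
    (T (ly 2) (ly 3) (ly 4)) (T (ly 2) (ly 3) (ly 5))).
Proof.
apply: (presents_of_keys se (K := nonzero_triples)) => // a b c.
have [t0 tS tR] := tri_alternating L.
have in345 z v w : z \in [:: lx 3; lx 4; lx 5] -> tri (e z) v w = 0.
  by rewrite !inE => /or3P[] /eqP->; apply: tri_Z1.
have x1y1 v : tri (e (lx 1)) (e (ly 1)) v = 0.
  by rewrite tR; apply: (tri_Z3 _ (a := ly 1)).
have x2l v w : w \in [:: lx 1; ly 1; ly 2] -> tri (e (lx 2)) (e w) v = 0.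
  move=> w1; rewrite tR tS tR tR [w](_ : _ = dual (dual w)); last by case: (w).
  by rewrite tri_Z2 ?oppr0 //; move: w1; elim/label_ind: w.
have y2y3 u : u \in saa_ucs L 3 -> tri u (e (ly 2)) (e (ly 3)) = 0.
  by move=> Uu; apply: (mul_vanishesP _ _ _ _ (L32_vanish Uu y2_L2) (lx 3)).
have x2y3 v : tri (e (lx 2)) (e (ly 3)) v = 0.
  by rewrite tR; apply: (tri_Z4 _ (a := ly 2)).
elim/label_ind: a; elim/label_ind: b => //; try by move=> *; rewrite in345.
all: try by move=> *; rewrite tR in345.
all: elim/label_ind: c => // _ _.
all: try by rewrite tR tR in345.
all: try by rewrite ?x2l ?x1y1 ?x2y3 ?y2y3.
all: by rewrite tS x2l ?oppr0.
Qed.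


Variables (r p1 p2 q1 q2 a b c d k1 k2 k3 k4 k5 k6 : F).
Let P := P_general r p1 p2 q1 q2 a b c d k1 k2 k3 k4 k5 k6.
Hypothesis pe : presents e P.

(** Otherwise x2 would be central. *)
Lemma adapted_r_neq0 : r != 0.
Proof.
apply/eqP => r0; have x2_Z1 : e (lx 2) \in saa_ucs L 1.
  apply/saa_ucsSP => v; rewrite memv0; apply/eqP/saa_form_nondeg => w.
  rewrite -/(tri _ _ _) (presents_tri _ _ _ pe).
  rewrite (eq_cubic _ (coord_in_basis _ se) (frefl _) (frefl _)).
  by rewrite cubic_P_general r0 /det3 /delta !rankE /=; ring.
have /eqP := allP (Z1_vanish x2_Z1) (lx 2) isT.
by rewrite coord_in_basis // deltaE eqxx => /eqP; rewrite oner_eq0.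
Qed.

(** The vectors x1, y1 and x2 have zero products with one another, and
    x2 y2 = 0; so only the part of v along y2 and those of u along x1, y1
    contribute. *)
Lemma mul_L3_L2 u v : u \in saa_ucs L 3 -> v \in saa_lcs L 2 ->
  saa_mul u v = coord_in e v (ly 2) *:
    (coord_in e u (lx 1) *: saa_mul (e (lx 1)) (e (ly 2)) +
     coord_in e u (ly 1) *: saa_mul (e (ly 1)) (e (ly 2))).
Proof.
move=> /Z3_vanish/allP Zu /L2_vanish/allP Zv.
apply/eqP; rewrite -subr_eq0; apply/eqP/saa_form_nondeg => w.
rewrite linearBl linearZl_LR linearDl !linearZl_LR /=.
rewrite -![saa_form (saa_mul _ _) _]/(tri _ _ _) !(presents_tri _ _ _ pe).
rewrite !(eq_cubic P (coord_in_basis _ se) (coord_in_basis _ se) (frefl _)).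
rewrite !cubic_P_general /det3 /delta !rankE /=.
rewrite (eqP (Zu (ly 2) isT)) (eqP (Zu (ly 3) isT)) (eqP (Zu (ly 4) isT))
  (eqP (Zu (ly 5) isT)) (eqP (Zv (ly 3) isT)) (eqP (Zv (ly 4) isT))
  (eqP (Zv (ly 5) isT)).
by ring.
Qed.

Lemma mul_L3_y3 u : u \in saa_ucs L 3 ->
  saa_mul u (e (ly 3)) =
    coord_in e u (lx 1) *: saa_mul (e (lx 1)) (e (ly 3)) +
    coord_in e u (ly 1) *: saa_mul (e (ly 1)) (e (ly 3)).
Proof.
move=> /Z3_vanish/allP Zu.
apply/eqP; rewrite -subr_eq0; apply/eqP/saa_form_nondeg => w.
rewrite linearBl linearDl !linearZl_LR /=.
rewrite -![saa_form (saa_mul _ _) _]/(tri _ _ _) !(presents_tri _ _ _ pe).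
rewrite !(eq_cubic P (coord_in_basis _ se) (coord_in_basis _ se) (frefl _)).
rewrite (eq_cubic P (frefl _) (coord_in_basis _ se) (frefl _)).
rewrite !cubic_P_general /det3 /delta !rankE /=.
rewrite (eqP (Zu (ly 2) isT)) (eqP (Zu (ly 3) isT)) (eqP (Zu (ly 4) isT))
  (eqP (Zu (ly 5) isT)).
by ring.
Qed.

Let vec_x45 u (k l : F) : (forall w, saa_form u w =
    k * coord_in e w (ly 4) + l * coord_in e w (ly 5)) ->
  u = k *: e (lx 4) + l *: e (lx 5).
Proof.
move=> uw; apply/eqP; rewrite -subr_eq0; apply/eqP/saa_form_nondeg => w.
by rewrite linearBl linearDl !linearZl_LR uw subrr.
Qed.

Let tri_basis a' b' w : tri (e a') (e b') w =
  cubic P (delta F a') (delta F b') (coord_in e w).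
Proof.
rewrite (presents_tri _ _ _ pe).
by apply: eq_cubic => //; apply: coord_in_basis.
Qed.

Lemma x1y2E : saa_mul (e (lx 1)) (e (ly 2)) = p1 *: e (lx 4) + p2 *: e (lx 5).
Proof.
apply: vec_x45 => w; rewrite -/(tri _ _ _) tri_basis cubic_P_general.
by rewrite /det3 /delta !rankE /=; ring.
Qed.

Lemma y1y2E : saa_mul (e (ly 1)) (e (ly 2)) = q1 *: e (lx 4) + q2 *: e (lx 5).
Proof.
apply: vec_x45 => w; rewrite -/(tri _ _ _) tri_basis cubic_P_general.
by rewrite /det3 /delta !rankE /=; ring.
Qed.

Lemma x1y3E : saa_mul (e (lx 1)) (e (ly 3)) = a *: e (lx 4) + b *: e (lx 5).
Proof.
apply: vec_x45 => w; rewrite -/(tri _ _ _) tri_basis cubic_P_general.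
by rewrite /det3 /delta !rankE /=; ring.
Qed.

Lemma y1y3E : saa_mul (e (ly 1)) (e (ly 3)) = c *: e (lx 4) + d *: e (lx 5).
Proof.
apply: vec_x45 => w; rewrite -/(tri _ _ _) tri_basis cubic_P_general.
by rewrite /det3 /delta !rankE /=; ring.
Qed.

Let D := p1 * q2 - p2 * q1.

(** The products x1 y2 and y1 y2 span L^3 L^2 = L^5, which contains x4, x5. *)
Lemma phi_det_neq0 : D != 0.
Proof.
pose W := (<[saa_mul (e (lx 1)) (e (ly 2))]> +
           <[saa_mul (e (ly 1)) (e (ly 2))]>)%VS.
have L5W : (saa_lcs L 5 <= W)%VS.
  rewrite -L32 Z3L; apply/saa_prodvP => u v Uu Vv; rewrite mul_L3_L2 //.
  by apply/rpredZ/memv_add; apply/rpredZ/memv_line.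
pose in_span u k l :=
  coord_in e u (lx 4) = k * p1 + l * q1 /\
  coord_in e u (lx 5) = k * p2 + l * q2.
have inW u : u \in W -> exists k l, in_span u k l.
  move=> /memv_addP[_ /vlineP[k ->] [_ /vlineP[l ->] ->]]; exists k, l.
  rewrite /in_span x1y2E y1y2E !(coord_inD, coord_inZ) !coord_in_basis //.
  by rewrite /delta !rankE /=; split; ring.
have [m4 [l4 []]] : exists k l, in_span (e (lx 4)) k l.
  by apply/inW/(subvP L5W); rewrite L5E memv_addl.
have [m5 [l5 []]] : exists k l, in_span (e (lx 5)) k l.
  by apply/inW/(subvP L5W); rewrite L5E memv_adds // memv_line.
rewrite !coord_in_basis // /delta !rankE /= => E54 E55 E44 E45.
apply/eqP => D0; have : (m4 * l5 - l4 * m5) * D = 1.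
  transitivity ((m4 * p1 + l4 * q1) * (m5 * p2 + l5 * q2) -
                (m4 * p2 + l4 * q2) * (m5 * p1 + l5 * q1)).
    by rewrite /D; ring.
  by rewrite -E54 -E55 -E44 -E45; ring.
by rewrite D0 mulr0 => /eqP; rewrite eq_sym oner_eq0.
Qed.

(** The section of phi used in tau is determined up to the kernel of phi, which
    has no part along x1, y1 as phi is invertible, so psi kills it too. *)
Lemma tau_mapE u : u \in saa_lcs L 3 ->
  tau_map e (saa_mul u (e (ly 2))) = saa_mul u (e (ly 3)).
Proof.
move=> Uu; pose v := vsproj (saa_lcs L 3) u.
have phiE w : phi_map e w = saa_mul (vsval w) (e (ly 2)).
  by rewrite comp_lfunE saa_rmulE lfunE.
have psiE w : psi_map e w = saa_mul (vsval w) (e (ly 3)).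
  by rewrite comp_lfunE saa_rmulE lfunE.
have uE : saa_mul u (e (ly 2)) = phi_map e v by rewrite phiE vsprojK.
rewrite /tau_map comp_lfunE /= psiE uE.
set w := (_^-1)%VF _; have : phi_map e w = phi_map e v.
  by rewrite limg_lfunVK // memv_img ?memvf.
rewrite !phiE vsprojK // => Ew; apply/eqP; rewrite -subr_eq0 -linearBl /=.
have Zd : vsval w - u \in saa_ucs L 3 by rewrite -Z3L rpredB // subvsP.
have : saa_mul (vsval w - u) (e (ly 2)) = 0 by rewrite linearBl /= Ew subrr.
rewrite mul_L3_y3 // mul_L3_L2 // coord_in_basis // deltaE eqxx scale1r.
rewrite x1y2E y1y2E; set k := coord_in _ _ _; set l := coord_in _ _ _ => E0.
have E4 : k * p1 + l * q1 = 0.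
  rewrite -(coord_in0 e (lx 4)) -E0 !(coord_inD, coord_inZ) !coord_in_basis //.
  by rewrite /delta !rankE /=; ring.
have E5 : k * p2 + l * q2 = 0.
  rewrite -(coord_in0 e (lx 5)) -E0 !(coord_inD, coord_inZ) !coord_in_basis //.
  by rewrite /delta !rankE /=; ring.
have k0 : k = 0.
  apply: (mulIf phi_det_neq0); rewrite mul0r.
  transitivity (q2 * (k * p1 + l * q1) - q1 * (k * p2 + l * q2)).
    by rewrite /D; ring.
  by rewrite E4 E5; ring.
have l0 : l = 0.
  apply: (mulIf phi_det_neq0); rewrite mul0r.
  transitivity (p1 * (k * p2 + l * q2) - p2 * (k * p1 + l * q1)).
    by rewrite /D; ring.
  by rewrite E4 E5; ring.
by rewrite k0 l0 !scale0r addr0.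
Qed.

(** Otherwise y3 - z y2 would annihilate x1 and y1, hence lie in Z_3 = L^3,
    whose elements have no part along y3. *)
Lemma psi_not_multiple z :
  ~ [/\ a = z * p1, b = z * p2, c = z * q1 & d = z * q2].
Proof.
case=> Ea Eb Ec Ed; pose y := e (ly 3) + (- z) *: e (ly 2).
have yE : coord_in e y =1 fun x => delta F (ly 3) x - z * delta F (ly 2) x.
  by move=> x; rewrite coord_inD coord_inZ !coord_in_basis // mulNr.
have : y \in saa_ucs L 3.
  apply/saa_ucsSP => v.
  apply: (vanishes_mem se (S := [:: lx 1; ly 1; ly 2; ly 3; ly 4; ly 5])).
    have Z12 w : w \in saa_ucs L 1 -> w \in saa_ucs L 2.
      by rewrite Z2E; apply: memv_adds.
    by elim/label_ind => //; rewrite orbC ?x2_Z2 ?Z12 //.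
  apply/allP => x Sx; rewrite coord_in_mul (presents_tri _ _ _ pe).
  rewrite (eq_cubic _ yE (frefl _) (coord_in_basis _ se)) cubic_P_general.
  rewrite Ea Eb Ec Ed /det3.
  move: Sx; elim/label_ind: x => // _; rewrite dualE /delta !rankE /=;
    by apply/eqP; ring.
move/Z3_vanish/allP/(_ (ly 3) isT); rewrite yE /delta !rankE /= mulr0 subr0.
by rewrite oner_eq0.
Qed.

(** Columns are in the order x5, x4 of the basis in which tau is written. *)
Lemma mul_tau_mx : mx2 p2 p1 q2 q1 *m tau_mx e = mx2 b a d c.
Proof.
set B := [tuple e (lx 5); e (lx 4)].
have freeB : free B.
  apply/freeP => k; rewrite !big_ord_recl big_ord0 addr0 /= => sum0.
  have E i :
      coord_in e (k ord0 *: e (lx 5) + k (lift ord0 ord0) *: e (lx 4)) i = 0.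
    by rewrite sum0 coord_in0.
  have := E (lx 5); have := E (lx 4).
  rewrite !(coord_inD, coord_inZ) !coord_in_basis // /delta !rankE /=.
  rewrite !mulr0 !mulr1 add0r addr0 => k1_0 k0_0 [[|[|//]] lt_i].
    by rewrite -[RHS]k0_0; congr (k _); apply: val_inj.
  by rewrite -[RHS]k1_0; congr (k _); apply: val_inj.
have coordB k l j :
    coord B j (k *: e (lx 4) + l *: e (lx 5)) = nth 0 [:: l; k] j.
  have E4 : coord B j (e (lx 4)) = (lift ord0 ord0 == j)%:R.
    exact: (coord_free (lift ord0 ord0) j freeB).
  have E5 : coord B j (e (lx 5)) = (ord0 == j)%:R.
    exact: (coord_free ord0 j freeB).
  rewrite linearD !linearZ /= E4 E5 /GRing.scale.
  by case: j {E4 E5} => [[|[|//]] lt_j] /=; ring.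
have x1_L3 : e (lx 1) \in saa_lcs L 3 by rewrite Z3L.
have y1_L3 : e (ly 1) \in saa_lcs L 3 by rewrite Z3L.
have tx := tau_mapE x1_L3; have ty := tau_mapE y1_L3.
rewrite x1y2E x1y3E linearD !linearZ /= in tx.
rewrite y1y2E y1y3E linearD !linearZ /= in ty.
apply/matrixP => i j; rewrite !mxE !big_ord_recl big_ord0 addr0 !mxE.
rewrite ![tnth _ _]/=.
case: i => [[|[|//]] lt_i] /=.
  transitivity (coord B j (a *: e (lx 4) + b *: e (lx 5))).
    by rewrite -tx linearD !linearZ /= addrC.
  by rewrite coordB; case: j => [[|[|//]] lt_j].
transitivity (coord B j (c *: e (lx 4) + d *: e (lx 5))).
  by rewrite -ty linearD !linearZ /= addrC.
by rewrite coordB; case: j => [[|[|//]] lt_j].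
Qed.

(** A root would be an eigenvalue of tau, and a root of its irreducible minimal
    polynomial; tau would be the scalar z, that is psi = z phi. *)
Lemma psi_no_root z : irreducible_poly (mxminpoly (tau_mx e)) ->
  (a - z * p1) * (d - z * q2) != (b - z * p2) * (c - z * q1).
Proof.
move=> irr; apply/eqP => root_z.
have mulz : mx2 p2 p1 q2 q1 *m (tau_mx e - z%:M) =
    mx2 (b - z * p2) (a - z * p1) (d - z * q2) (c - z * q1).
  rewrite mulmxBr mul_tau_mx mul_mx_scalar; apply/matrixP => i j.
  by rewrite !mxE; case: i j => [[|[|//]] ?] [[|[|//]] ?].
have detz : \det (tau_mx e - z%:M) = 0.
  apply: (mulfI (_ : - D != 0)); first by rewrite oppr_eq0 phi_det_neq0.
  have -> : - D = \det (mx2 p2 p1 q2 q1) by rewrite det_mx2 /D; ring.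
  by rewrite mulr0 -det_mulmx mulz det_mx2 root_z; ring.
have tauz := irreducible_minpoly_scalar irr detz.
have := mul_tau_mx; rewrite tauz mul_mx_scalar => /matrixP Ez.
apply: (psi_not_multiple (z := z)); split.
- by have := Ez ord0 (lift ord0 ord0); rewrite !mxE.
- by have := Ez ord0 ord0; rewrite !mxE.
- by have := Ez (lift ord0 ord0) (lift ord0 ord0); rewrite !mxE.
- by have := Ez (lift ord0 ord0) ord0; rewrite !mxE.
Qed.

End Adapted.

(** * Existence of the presentation and the classification *)

Section NormalForm.
Variables (F : fieldType) (charF : 2%N \notin [pchar F]) (L : saa F).

Let two0 : 2%:R != 0 :> F. Proof. by apply: contra charF => z; apply/andP. Qed.

(** The absence of roots of det (psi - z) is used at z = a, where it gives
    c != 0, and at z = (a + d) / 2 + c y, where it says that s is not y^2. *)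
Lemma normal_form_psi (e : label -> L) (r a b c d k1 k2 k3 k4 k5 k6 : F) :
    r != 0 -> (forall z, (a - z) * (d - z) != b * c) ->
    presents e (P_general r 1 0 0 1 a b c d k1 k2 k3 k4 k5 k6) ->
  exists s, ~ is_square s /\ exists e' : label -> L, presents e' (P10_3_8 r s).
Proof.
move=> r0 no_root pe; have c0 : c != 0.
  by apply/eqP => c0; have /eqP[] := no_root a; rewrite c0; ring.
have [e1 pe1] := normalize_psi two0 c0 pe.
have [e2 pe2] := normalize_rest r0 pe1.
exists ((((a - d) / 2%:R) ^+ 2 + b * c) / c ^+ 2); split; last by exists e2.
case=> y Ey; have /eqP[] := no_root ((a + d) / 2%:R + c * y).
have -> : b * c = c ^+ 2 * y ^+ 2 - ((a - d) / 2%:R) ^+ 2.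
  by rewrite -Ey; field; rewrite ?c0 ?two0.
by field; rewrite ?c0 ?two0.
Qed.

Lemma normal_form (e : label -> L)
    (r p1 p2 q1 q2 a b c d k1 k2 k3 k4 k5 k6 : F) :
    r != 0 -> p1 * q2 - p2 * q1 != 0 ->
    (forall z, (a - z * p1) * (d - z * q2) != (b - z * p2) * (c - z * q1)) ->
    presents e (P_general r p1 p2 q1 q2 a b c d k1 k2 k3 k4 k5 k6) ->
  exists r' s, admissible r' s /\
    exists e' : label -> L, presents e' (P10_3_8 r' s).
Proof.
set D := p1 * q2 - p2 * q1 => r0 D0 no_root pe.
have [e1 pe1] := normalize_phi D0 pe.
have rD0 : r / D != 0 by rewrite mulf_neq0 ?invr_neq0.
have [|s [nsq pe2]] := normal_form_psi rD0 _ pe1; last by exists (r / D), s.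
(* With phi made the identity, psi becomes psi times the inverse of phi; so
   det (psi - z phi) only changes by the factor D. *)
have Ea : a = (a * q2 - b * q1) / D * p1 + (b * p1 - a * p2) / D * q1.
  by rewrite /D; field.
have Eb : b = (a * q2 - b * q1) / D * p2 + (b * p1 - a * p2) / D * q2.
  by rewrite /D; field.
have Ec : c = (c * q2 - d * q1) / D * p1 + (d * p1 - c * p2) / D * q1.
  by rewrite /D; field.
have Ed : d = (c * q2 - d * q1) / D * p2 + (d * p1 - c * p2) / D * q2.
  by rewrite /D; field.
move=> z; apply: contra (no_root z); move: Ea Eb Ec Ed.
move: (_ / D) (_ / D) (_ / D) (_ / D) => d' c' b' a' -> -> -> ->.
move=> /eqP Ez; rewrite -subr_eq0; apply/eqP.
transitivity (D * ((a' - z) * (d' - z) - b' * c')); first by rewrite /D; ring.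
by rewrite Ez subrr mulr0.
Qed.

Lemma type_C_presentation :
    saa_prodv (saa_lcs L 3) (saa_lcs L 2) = saa_lcs L 5 -> type_C L ->
  exists r s : F, admissible r s /\ has_presentation L (P10_3_8 r s).
Proof.
move=> L32 [e ae irr]; have pe := adapted_presents ae L32; cbv zeta in pe.
have D0 := phi_det_neq0 ae L32 pe.
have no_root z := psi_no_root ae L32 pe z irr.
have [r [s [adm pe']]] := normal_form (adapted_r_neq0 ae pe) D0 no_root pe.
by exists r, s; split=> //; apply/(has_presentationP _ (P10_3_8_keys r s)).
Qed.

End NormalForm.

Theorem proposition7p17 (F : fieldType) (charF : 2%N \notin [pchar F]) :
  (forall L : saa F,
     saa_nilpotent L -> \dim {:L} = 10%N ->
     saa_isotropic (saa_center L) -> \dim (saa_center L) = 3%N ->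
     \dim (saa_lcs L 3) = 6%N ->
     saa_prodv (saa_lcs L 3) (saa_lcs L 2) = saa_lcs L 5 ->
     type_C L ->
     exists r s : F, admissible r s /\ has_presentation L (P10_3_8 r s)) /\
  (forall r s r' s' : F, admissible r s -> admissible r' s' ->
     (same_algebra (P10_3_8 r' s') (P10_3_8 r s) <->
      is_nonzero_cube (r' / r) /\ inG s (s / s'))).
Proof.
split=> [L _ _ _ _ _ | r s r' s']; first exact: type_C_presentation.
exact: same_algebraP.
Qed.
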